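(* Fix $0<\epsilon<1/12$. Let $\sigma\in\mathbb{C}^{d\times d}$ be a density matrix and let $\sigma^*$ be obtained from $\sigma$ by the mass-removal scheme described in the context (zeroing out at most $12\epsilon$ of eigenvalue mass). Then any algorithm that $\epsilon$-certifies $\sigma$ must use at least $\tilde\Omega(\|\sigma^*\|_{1/2}/\epsilon^2)$ copies of the unknown state, i.e., there are absolute constants $c,C>0$ such that at least $c\,\|\sigma^*\|_{1/2}/(\epsilon^2\log^C(d/\epsilon))$ copies are needed (for $d/\epsilon$ bounded away from $1$).
   Context: Task ($\epsilon$-certification of $\sigma$): a density matrix $\sigma$ is given by explicit description; the algorithm receives $n$ copies of an unknown density matrix $\rho$, promised that either $\rho=\sigma$ or $\|\rho-\sigma\|_1\ge\epsilon$ (trace norm), and must decide which holds with probability at least $2/3$ using arbitrary measurements, possibly entangled across all copies. For $p>0$, $\|X\|_p=(\sum_i s_i(X)^p)^{1/p}$ is the Schatten-$p$ (quasi)norm; so $\|\sigma^*\|_{1/2}=(\operatorname{tr}\sqrt{\sigma^*})^2$. Mass-removal scheme: write $\sigma=\mathrm{diag}(\lambda_1,\dots,\lambda_d)$ in an eigenbasis, considering only its nonzero eigenvalues (the argument is restricted to the support of $\sigma$). For $j\in\mathbb{Z}_{\ge0}$ let bucket $S_j=\{i:\lambda_i\in(2^{-j-1},2^{-j}]\}$, $d_j=|S_j|$, and $j(i)$ the bucket containing $i$. Sort indices in increasing order of $\hat\lambda_i=\lambda_i/d_{j(i)}$ (ties broken arbitrarily), relabeling so that $\hat\lambda_1\le\dots\le\hat\lambda_d$.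 Let $d'<d$ be the largest index with $\sum_{i=1}^{d'}\lambda_i\le 12\epsilon$ ($d'=0$ if none), and let $\sigma^*$ be the diagonal matrix obtained by zeroing out the entries $\lambda_1,\dots,\lambda_{d'}$ of $\sigma$.
   Formalization: The dimension is assumed to satisfy d ≥ 2; for d = 1 the only density matrix is σ itself, so zero copies certify it and the claimed positive lower bound fails. *)

(* Defs.v *)
From HB Require Import structures.
From mathcomp Require Import all_boot all_order all_algebra.
From mathcomp Require Import spectral mxtens.
From mathcomp Require Import complex.
From mathcomp Require Import boolp classical_sets reals exp.

Set Implicit Arguments.
Unset Strict Implicit.
Unset Printing Implicit Defensive.

Import Order.TTheory GRing.Theory Num.Theory.
Local Open Scope complex_scope.
Local Open Scope ring_scope.

Section QCert.
Variable R : realType.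
Local Notation C := R[i].

Definition adjmx {m n} (A : 'M[C]_(m, n)) : 'M[C]_(n, m) := map_mx Num.conj (A^T).

Definition hermitian {n} (A : 'M[C]_n) : Prop := adjmx A = A.

Definition psd {n} (A : 'M[C]_n) : Prop :=
  hermitian A /\ forall v : 'rV[C]_n, 0 <= (v *m A *m adjmx v) 0 0.

Definition density {n} (A : 'M[C]_n) : Prop := psd A /\ \tr A = 1.

Definition schatten {n} (p : R) (X : 'M[C]_n) : R :=
  xget 0 [set t : R | exists (U V : 'M[C]_n) (s : 'I_n -> R),
    [/\ U \is unitarymx, V \is unitarymx, (forall i, 0 <= s i),
        X = U *m diag_mx (\row_i (s i)%:C) *m adjmx V &
        t = powR (\sum_i powR (s i) p) p^-1]].

Definition tpow {d} (A : 'M[C]_d) (n : nat) : 'M[C]_(d ^ n) := ntensmx A n.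

(* A two-outcome measurement {M, 1 - M} on n copies ("accept" = "rho = sigma")
   that eps-certifies sigma with success probability >= 2/3. *)
Definition certifies {d} (sigma : 'M[C]_d) (eps : R) (n : nat)
    (M : 'M[C]_(d ^ n)) : Prop :=
  [/\ psd M, psd (1 - M),
      (2%:R / 3%:R)%:C <= 'Re (\tr (M *m tpow sigma n)) &
      forall rho : 'M[C]_d, density rho -> eps <= schatten 1 (rho - sigma) ->
        'Re (\tr (M *m tpow rho n)) <= (1 / 3%:R)%:C].

Section MassRemoval.
Variables (d : nat) (lam : 'I_d -> R).

Definition supp : {set 'I_d} := [set i | lam i != 0].

Definition in_bucket (j : nat) (a : R) : Prop := 2 ^- j.+1 < a /\ a <= 2 ^- j.

Definition same_bucket (a b : R) : Prop := exists j : nat, in_bucket j a /\ in_bucket j b.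

Definition bucket_size (i : 'I_d) : nat :=
  #|[set k in supp | `[< same_bucket (lam i) (lam k) >] ]|.

Definition lhat (i : 'I_d) : R := lam i / (bucket_size i)%:R.

Definition valid_order (s : seq 'I_d) : Prop :=
  perm_eq s (enum supp) /\ sorted (fun a b => lhat a <= lhat b) s.

Definition dprime (eps : R) (s : seq 'I_d) : nat :=
  \max_(k < size s | \sum_(i <- take k s) lam i <= 12%:R * eps) (k : nat).

(* sigma^* : diagonal matrix (in the eigenbasis) with lambda_1..lambda_{d'} zeroed *)
Definition sigma_star (eps : R) (s : seq 'I_d) : 'M[C]_d :=
  diag_mx (\row_i (if i \in drop (dprime eps s) s then lam i else 0)%:C).

End MassRemoval.
End QCert.

Arguments certifies {R d} sigma eps n M.

(* Main.v *)
(* The lower bound tests sigma against a mixture of perturbed states.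

   Write s_i = lam_i^(1/4).  In the eigenbasis of sigma take
   rho_z = diag(s) (diag(sqrt lam) + E_z) diag(s), where E_z = D_z E D_z for
   random signs z and E is built inside buckets of nearly equal eigenvalues from
   flat symmetric matrices W with zero diagonal, W^2 = 1 and W_ij^2 either 0 or
   2/N (off-diagonal Hadamard blocks).  A measurement separating sigma^(n) from
   all rho_z^(n) forces E_w (1 + Q(w))^n >= 10/9, where Q is a quadratic form in
   random signs; since Q <= sum_k theta^2 2^-(k+1) (sum_(i in G_k) w_i)^2 / N_k,
   its exponential moment is controlled by integrating out one sign at a time.
   For a union of buckets of total mass p >= 4 eps this gives
   2^k0 p^2 = O(n eps^2), where k0 is the smallest bucket index used.

   If i is kept by the mass removal, the indices with lhat at most lhat_i carry
   mass more than 12 eps.  Either the bucket of i is heavy, or those indices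
   outside singleton buckets are, and in both cases d_j(i)^2 lam_i = O(n eps^2);
   when d_j(i) = 1 one instead uses the bound n eps^2 >= c, which a single nearby
   state (a rotation, or a reweighting of the spectrum) gives for every sigma.
   Hence sqrt lam_i = O(eps sqrt n) / d_j(i), and summing over the O(log (d/eps))
   kept buckets loses two logarithms. *)
Require Import Defs.
From HB Require Import structures.
From mathcomp Require Import all_boot all_order all_algebra.
From mathcomp Require Import spectral mxtens.
From mathcomp Require Import complex.
From mathcomp Require Import boolp classical_sets reals exp.
From mathcomp Require Import sequences.
From mathcomp Require Import ring lra zify.
Set Implicit Arguments.
Unset Strict Implicit.
Unset Printing Implicit Defensive.
Import Order.TTheory GRing.Theory Num.Theory.
Local Open Scope complex_scope.
Local Open Scope ring_scope.

(** * Hermitian matrices and the trace norm *)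

Section ComplexMatrices.
Variable R : realType.
Local Notation C := R[i].

Definition retr n (A : 'M[C]_n) : R := complex.Re (\tr A).
Definition fnorm2 m n (A : 'M[C]_(m, n)) : R := retr (A *m adjmx A).
(** Operator norm at most 1, tested by right multiplication on rectangular matrices, so that it
    applies to single rows as well as to square matrices. *)
Definition contraction n (K : 'M[C]_n) : Prop :=
  forall m (X : 'M[C]_(m, n)), fnorm2 (X *m K) <= fnorm2 X.

Lemma adjmxE m n (A : 'M[C]_(m, n)) i j : adjmx A i j = (A j i)^*%C.
Proof. by rewrite !mxE. Qed.

Lemma adjmxK m n (A : 'M[C]_(m, n)) : adjmx (adjmx A) = A.
Proof. by apply/matrixP => i j; rewrite !adjmxE conjcK. Qed.

Lemma adjmxM m n p (A : 'M[C]_(m, n)) (B : 'M[C]_(n, p)) :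
  adjmx (A *m B) = adjmx B *m adjmx A.
Proof. by rewrite /adjmx trmx_mul map_mxM. Qed.

Lemma adjmxD m n (A B : 'M[C]_(m, n)) : adjmx (A + B) = adjmx A + adjmx B.
Proof. by rewrite /adjmx linearD map_mxD. Qed.

Lemma adjmxB m n (A B : 'M[C]_(m, n)) : adjmx (A - B) = adjmx A - adjmx B.
Proof. by rewrite /adjmx linearB map_mxB. Qed.

Lemma adjmx1 n : adjmx (1%:M : 'M[C]_n) = 1%:M.
Proof. by rewrite /adjmx trmx1 map_mx1. Qed.

Lemma adjmxZ m n (t : R) (A : 'M[C]_(m, n)) :
  adjmx (t%:C *: A) = t%:C *: adjmx A.
Proof.
by apply/matrixP => i j; rewrite !mxE; case: (A j i) => a b; apply/eqP; rewrite eq_complex /=; apply/andP; split; apply/eqP; ring.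
Qed.

Lemma adjmx_sum m n (I : finType) (F : I -> 'M[C]_(m, n)) :
  adjmx (\sum_i F i) = \sum_i adjmx (F i).
Proof.
apply: (big_morph (@adjmx R m n)) => [A B|]; first exact: adjmxD.
by rewrite /adjmx trmx0 map_mx0.
Qed.

Lemma ReD (x y : C) : complex.Re (x + y) = complex.Re x + complex.Re y.
Proof. by case: x => ? ?; case: y. Qed.

Lemma ReN (x : C) : complex.Re (- x) = - complex.Re x.
Proof. by case: x. Qed.

Lemma ReZ (t : R) (x : C) : complex.Re (t%:C * x) = t * complex.Re x.
Proof. by case: x => a b /=; rewrite mul0r subr0. Qed.

Lemma ReJ (x : C) : complex.Re (x^*%C) = complex.Re x.
Proof. by case: x. Qed.

Lemma Re_sum (I : finType) (P : pred I) (F : I -> C) :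
  complex.Re (\sum_(i | P i) F i) = \sum_(i | P i) complex.Re (F i).
Proof. exact: (big_morph _ ReD erefl). Qed.

Lemma retrD n (A B : 'M[C]_n) : retr (A + B) = retr A + retr B.
Proof. by rewrite /retr linearD ReD. Qed.

Lemma retrN n (A : 'M[C]_n) : retr (- A) = - retr A.
Proof. by rewrite /retr linearN ReN. Qed.

Lemma retrB n (A B : 'M[C]_n) : retr (A - B) = retr A - retr B.
Proof. by rewrite retrD retrN. Qed.

Lemma retrZ n (t : R) (A : 'M[C]_n) : retr (t%:C *: A) = t * retr A.
Proof. by rewrite /retr linearZ ReZ. Qed.

Lemma retr_sum n (I : finType) (F : I -> 'M[C]_n) :
  retr (\sum_i F i) = \sum_i retr (F i).
Proof.
by apply: (big_morph (@retr n) (@retrD n)); rewrite /retr linear0.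
Qed.

Lemma retr_adj n (A : 'M[C]_n) : retr (adjmx A) = retr A.
Proof.
rewrite /retr /mxtrace !Re_sum; apply: eq_bigr => i _.
by rewrite adjmxE ReJ.
Qed.

Lemma retrC m n (A : 'M[C]_(m, n)) (B : 'M[C]_(n, m)) :
  retr (A *m B) = retr (B *m A).
Proof. by rewrite /retr mxtrace_mulC. Qed.

Lemma fnorm2E m n (A : 'M[C]_(m, n)) :
  fnorm2 A = \sum_i \sum_j (complex.Re (A i j) ^+ 2 + complex.Im (A i j) ^+ 2).
Proof.
rewrite /fnorm2 /retr /mxtrace Re_sum; apply: eq_bigr => i _.
rewrite mxE Re_sum; apply: eq_bigr => j _; rewrite adjmxE.
by case: (A i j) => a b /=; ring.
Qed.

Lemma fnorm2_ge0 m n (A : 'M[C]_(m, n)) : 0 <= fnorm2 A.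
Proof.
rewrite fnorm2E; apply: sumr_ge0 => i _; apply: sumr_ge0 => j _.
by rewrite addr_ge0 ?sqr_ge0.
Qed.

Lemma fnorm2_adj m n (A : 'M[C]_(m, n)) : fnorm2 (adjmx A) = fnorm2 A.
Proof. by rewrite /fnorm2 adjmxK retrC. Qed.

Lemma fnorm2B m n (A B : 'M[C]_(m, n)) :
  fnorm2 (A - B) = fnorm2 A - 2 * retr (A *m adjmx B) + fnorm2 B.
Proof.
rewrite /fnorm2 adjmxB mulmxBl !mulmxBr !retrB.
have -> : retr (B *m adjmx A) = retr (A *m adjmx B).
  by rewrite -retr_adj adjmxM adjmxK.
ring.
Qed.

Lemma fnorm2Z m n (t : R) (A : 'M[C]_(m, n)) :
  fnorm2 (t%:C *: A) = t ^+ 2 * fnorm2 A.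
Proof. by rewrite /fnorm2 adjmxZ -scalemxAl -scalemxAr !retrZ; ring. Qed.

(** Cauchy-Schwarz in the form of an expanded square. The free weight [t] replaces square roots of
    norms; each use picks a suitable value. *)
Lemma retr_AMGM m n (t : R) (A : 'M[C]_(m, n)) (B : 'M[C]_(n, m)) :
  2 * t * retr (A *m B) <= t ^+ 2 * fnorm2 A + fnorm2 B.
Proof.
have := fnorm2_ge0 (t%:C *: A - adjmx B).
by rewrite fnorm2B fnorm2Z fnorm2_adj adjmxK -scalemxAl retrZ; lra.
Qed.

Lemma psd_retr_ge0 m n (P : 'M[C]_n) (X : 'M[C]_(m, n)) :
  psd P -> 0 <= retr (X *m P *m adjmx X).
Proof.
move=> [_ P0]; rewrite /retr /mxtrace Re_sum; apply: sumr_ge0 => i _.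
have := P0 (row i X); rewrite lecE /= => /andP[_].
have -> // : (X *m P *m adjmx X) i i = (row i X *m P *m adjmx (row i X)) 0 0.
have -> : adjmx (row i X) = col i (adjmx X).
  by apply/matrixP => a b; rewrite !mxE.
by rewrite -!row_mul !mxE; apply: eq_bigr => j _; rewrite !mxE.
Qed.

(** The reason is 1 - M^2 = (1 - M) + M (1 - M) M + (1 - M) M (1 - M), where every summand is
    positive semidefinite. *)
Lemma effect_contraction n (M : 'M[C]_n) :
  psd M -> psd (1%:M - M) -> contraction M.
Proof.
move=> PM P1 m X; have hM : adjmx M = M by case: PM.
have h1 : adjmx (1%:M - M) = 1%:M - M by case: P1.
have a1 := psd_retr_ge0 X P1.
have a2 := psd_retr_ge0 (X *m M) P1.
have a3 := psd_retr_ge0 (X *m (1%:M - M)) PM.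
rewrite -subr_ge0 /fnorm2.
have -> : retr (X *m adjmx X) - retr (X *m M *m adjmx (X *m M)) =
  retr (X *m (1%:M - M) *m adjmx X)
  + retr (X *m M *m (1%:M - M) *m adjmx (X *m M))
  + retr (X *m (1%:M - M) *m M *m adjmx (X *m (1%:M - M))).
  rewrite !adjmxM hM h1 -retrB -!retrD; congr retr.
  rewrite !mulmxA -!mulmxBl -!mulmxDl; congr (_ *m _).
  rewrite -[X in X - _](mulmx1 X) -!mulmxA -mulmxBr -!mulmxDr; congr (_ *m _).
  rewrite !(mulmxBl, mulmxBr, mul1mx, mulmx1, opprB) !mulmxA.
  move: (M *m M) (M *m M *m M) => M2 M3.
  apply/matrixP => i j; rewrite !mxE; ring.
by rewrite !addr_ge0.
Qed.

Lemma psd_mul_adj m n (A : 'M[C]_(m, n)) : psd (A *m adjmx A).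
Proof.
split; first by rewrite /Defs.hermitian adjmxM adjmxK.
move=> v; rewrite mulmxA -mulmxA -adjmxM.
rewrite mxE; apply: sumr_ge0 => j _; rewrite adjmxE; exact: mulcJ_ge0.
Qed.

Lemma psdD n (A B : 'M[C]_n) : psd A -> psd B -> psd (A + B).
Proof.
move=> [hA A0] [hB B0]; split; first by rewrite /Defs.hermitian adjmxD hA hB.
by move=> v; rewrite mulmxDr mulmxDl mxE addr_ge0.
Qed.

Lemma psd_conj m n (A : 'M[C]_n) (B : 'M[C]_(m, n)) :
  psd A -> psd (B *m A *m adjmx B).
Proof.
move=> [hA A0]; split.
  by rewrite /Defs.hermitian !adjmxM adjmxK hA mulmxA.
by move=> v; have := A0 (v *m B); rewrite adjmxM !mulmxA.
Qed.

Lemma unitaryV n (U : 'M[C]_n) : U \is unitarymx -> U *m adjmx U = 1%:M.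
Proof. by move=> /unitarymxP. Qed.

Lemma unitaryVl n (U : 'M[C]_n) : U \is unitarymx -> adjmx U *m U = 1%:M.
Proof. by move=> /unitaryV/mulmx1C. Qed.

Lemma unitary_contraction n (U : 'M[C]_n) : U \is unitarymx -> contraction U.
Proof.
move=> hU m X.
by rewrite /fnorm2 adjmxM !mulmxA -(mulmxA X) unitaryV // mulmx1.
Qed.

Lemma unitary_adj n (U : 'M[C]_n) : U \is unitarymx -> adjmx U \is unitarymx.
Proof. by move=> hU; apply/unitarymxP; rewrite -/(adjmx _) adjmxK unitaryVl. Qed.

Lemma mulmx_unitaryK m n (X : 'M[C]_(m, n)) (V : 'M[C]_n) :
  V \is unitarymx -> X *m adjmx V *m V = X.
Proof. by move=> hV; rewrite -mulmxA unitaryVl // mulmx1. Qed.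

Lemma contractionM n (K L : 'M[C]_n) :
  contraction K -> contraction L -> contraction (K *m L).
Proof. by move=> hK hL m X; rewrite mulmxA (le_trans (hL _ _)). Qed.

Lemma hermitian_spectral n (X : 'M[C]_n) : Defs.hermitian X ->
  exists (P : 'M[C]_n) (r : 'I_n -> R),
    P \is unitarymx /\ X = adjmx P *m diag_mx (\row_i (r i)%:C) *m P.
Proof.
move=> hX.
have hS : X \is hermsymmx.
  by apply/is_hermitianmxP; rewrite expr0 scale1r; exact: (esym hX).
have /mxOverP realD := hermitian_spectral_diag_real hS.
have /hermitian_normalmx /orthomx_spectralP := hS.
have hP := spectral_unitarymx X.
rewrite invmx_unitary // => XE.
exists (spectralmx X), (fun i => complex.Re (spectral_diag X 0 i)).
split; first exact: hP.
rewrite [LHS]XE; congr (_ *m diag_mx _ *m _).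
by apply/rowP => i; rewrite mxE RRe_real.
Qed.

(** The signs of the eigenvalues are moved into the right unitary factor. *)
Lemma hermitian_svd n (X : 'M[C]_n) : Defs.hermitian X ->
  exists (U V : 'M[C]_n) (s : 'I_n -> R),
  [/\ U \is unitarymx, V \is unitarymx, (forall i, 0 <= s i) &
      X = U *m diag_mx (\row_i (s i)%:C) *m adjmx V].
Proof.
move=> /hermitian_spectral[P [r [hP XE]]].
(* A zero eigenvalue gets sign 1, so that [S] is a unitary involution. *)
pose sg i : R := if 0 <= r i then 1 else -1.
have [S SE] : exists S : 'M[C]_n, S = diag_mx (\row_i (sg i)%:C) by eexists.
have sg2 i : sg i * sg i = 1 by rewrite /sg; case: ifP => _; ring.
have hSa : adjmx S = S.
  apply/matrixP => i j; rewrite SE adjmxE !mxE eq_sym.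
  by case: eqP => [->|_]; rewrite ?mulr1n ?mulr0n /= ?oppr0.
have SS : S *m S = 1%:M.
  apply/matrixP => i j; rewrite SE mul_diag_mx !mxE.
  by case: eqP => _; rewrite ?mulr1n ?mulr0n ?mulr0 // -rmorphM sg2.
have hS' : S \is unitarymx by apply/unitarymxP; rewrite -/(adjmx _) hSa.
have DS : diag_mx (\row_i (r i)%:C) = diag_mx (\row_i (`|r i|)%:C) *m S.
  apply/matrixP => i j; rewrite SE mul_diag_mx !mxE.
  case: (eqVneq i j) => _; rewrite ?mulr1n ?mulr0n ?mulr0 // -rmorphM.
  congr (_ %:C); rewrite /sg; case: ifP => h.
    by rewrite ger0_norm // mulr1.
  by rewrite ltr0_norm ?mulrN1 ?opprK // ltNge h.
exists (adjmx P), (adjmx (S *m P)), (fun i => `|r i|); split.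
- exact: unitary_adj.
- by apply: unitary_adj; apply: mul_unitarymx.
- by move=> i; apply: normr_ge0.
- by rewrite adjmxK XE DS !mulmxA.
Qed.

(** [schatten] picks its value by [xget]. Exhibiting one decomposition rules out the default, so the
    picked value comes with a decomposition of its own, and that one is returned. *)
Lemma schatten1_svd n (X : 'M[C]_n) : Defs.hermitian X ->
  exists (U V : 'M[C]_n) (s : 'I_n -> R),
  [/\ U \is unitarymx, V \is unitarymx, (forall i, 0 <= s i),
      X = U *m diag_mx (\row_i (s i)%:C) *m adjmx V &
      schatten 1 X = \sum_i s i].
Proof.
move=> /hermitian_svd[U0 [V0 [s0 [hU0 hV0 s00 XE0]]]].
have ne : exists t : R, exists (U V : 'M[C]_n) (s : 'I_n -> R),
    [/\ U \is unitarymx, V \is unitarymx, (forall i, 0 <= s i),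
        X = U *m diag_mx (\row_i (s i)%:C) *m adjmx V &
        t = powR (\sum_i powR (s i) 1) 1^-1].
  by eexists; exists U0, V0, s0; split.
have := xgetPex 0 ne; rewrite -/(schatten 1 X).
move=> [U [V [s [hU hV' sp XE2 ->]]]]; exists U, V, s; split => //.
rewrite invr1 powRr1; last by apply: sumr_ge0 => i _; exact: powR_ge0.
by apply: eq_bigr => i _; rewrite powRr1.
Qed.

(** One half of trace-norm duality: the trace is the sum of s_i times the i-th diagonal entry of V^*
    K U, and that entry has real part at most 1 by Cauchy-Schwarz for unit vectors. *)
Lemma retr_le_schatten1 n (X K : 'M[C]_n): Defs.hermitian X -> contraction K ->
  retr (X *m K) <= schatten 1 X.
Proof.
move=> /schatten1_svd [U [V [s [hU hV s0 XE ->]]]] hK.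
rewrite {1}XE -!mulmxA retrC -mulmxA /retr /mxtrace Re_sum.
apply: ler_sum => i _; rewrite mul_diag_mx mxE mxE ReZ ler_piMr //.
have -> : complex.Re ((adjmx V *m K *m U) i i) =
    retr ((row i (adjmx V) *m K) *m (col i U)).
  rewrite /retr /mxtrace big_ord1 -!row_mul !mxE.
  congr complex.Re; apply: eq_bigr => j _; rewrite !mxE; congr (_ * _).
have := retr_AMGM 1 (row i (adjmx V) *m K) (col i U).
have := hK _ (row i (adjmx V)).
have row1 (W : 'M[C]_n) : W \is unitarymx -> fnorm2 (row i W) = 1.
  move=> hW; rewrite /fnorm2 /retr /mxtrace big_ord1.
  have := unitaryV hW => /matrixP/(_ i i).
  rewrite !mxE eqxx /= => e1; rewrite (_ : \sum_j _ = 1) //.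
  by rewrite -[RHS]e1; apply: eq_bigr => j _; rewrite !mxE.
have -> : fnorm2 (col i U) = 1.
  rewrite -fnorm2_adj -[RHS](row1 _ (unitary_adj hU)); congr fnorm2.
  by apply/matrixP => a b; rewrite !mxE.
by rewrite row1 ?unitary_adj //; lra.
Qed.

End ComplexMatrices.

(** * Tensor powers *)

Section TensorPowers.
Variable R : realType.
Local Notation C := R[i].

Lemma tpowSS d (A : 'M[C]_d) n : tpow A n.+2 = A *t tpow A n.+1.
Proof. by []. Qed.

Lemma tpowM d (A B : 'M[C]_d) n : tpow (A *m B) n = tpow A n *m tpow B n.
Proof.
case: n => [|n]; first by rewrite /tpow /ntensmx mulmx1.
by elim: n => [//|n IH]; rewrite !tpowSS IH tensmx_mul.
Qed.

Lemma adjmx_tens m n p q (A : 'M[C]_(m, n)) (B : 'M[C]_(p, q)) :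
  adjmx (A *t B) = adjmx A *t adjmx B.
Proof. by rewrite /adjmx trmx_tens map_mxT. Qed.

Lemma adjmx_tpow d (A : 'M[C]_d) n : adjmx (tpow A n) = tpow (adjmx A) n.
Proof.
case: n => [|n]; first by rewrite /tpow /ntensmx adjmx1.
by elim: n => [//|n IH]; rewrite !tpowSS adjmx_tens IH.
Qed.

Lemma mxtrace_tens m n (A : 'M[C]_m) (B : 'M[C]_n) :
  \tr (A *t B) = \tr A * \tr B.
Proof. by rewrite /mxtrace mulr_sum; apply: eq_bigr => i _; rewrite mxE. Qed.

Lemma mxtrace_tpow d (A : 'M[C]_d) n : \tr (tpow A n) = \tr A ^+ n.
Proof.
case: n => [|n]; first by rewrite /tpow /ntensmx mxtrace1.
elim: n => [|n IH]; first by rewrite expr1.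
by rewrite tpowSS mxtrace_tens IH [RHS]exprS.
Qed.

Lemma certifies_retr d (sigma : 'M[C]_d) (eps : R) n (M : 'M[C]_(d ^ n)) :
  certifies sigma eps n M ->
  [/\ psd M, psd (1%:M - M), 2 / 3 <= retr (M *m tpow sigma n) &
    forall rho : 'M[C]_d, density rho -> eps <= schatten 1 (rho - sigma) ->
      retr (M *m tpow rho n) <= 1 / 3].
Proof.
move=> [PM P1 h1 h2]; split => //.
  by move: h1; rewrite -complexRe lecR.
by move=> rho hr he; move: (h2 rho hr he); rewrite -complexRe lecR.
Qed.

Lemma bernoulli_compl (f : R) n : 0 <= f <= 1 -> 1 - f ^+ n <= n%:R * (1 - f).
Proof.
move=> /andP[f0 f1]; elim: n => [|n IH]; first by rewrite expr0 subrr mul0r.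
have : f ^+ n <= 1 by rewrite exprn_ile1.
rewrite exprS -natr1 => h.
have : 0 <= (1 - f) * (1 - f ^+ n) by apply: mulr_ge0; rewrite subr_ge0.
by nra.
Qed.

(** Since [M] is Hermitian, the two cross terms have the same real trace and cancel. *)
Lemma retr_sandwichB m n (M : 'M[C]_m) (X Y : 'M[C]_(m, n)) : adjmx M = M ->
  retr (M *m (X *m adjmx X)) - retr (M *m (Y *m adjmx Y)) =
  retr ((adjmx X *m M) *m (X - Y)) + retr ((adjmx Y *m M) *m (X - Y)).
Proof.
move=> hM.
have e (Z : 'M[C]_(m, n)) :
    retr (M *m (Z *m adjmx Z)) = retr (adjmx Z *m M *m Z).
  by rewrite mulmxA retrC mulmxA.
have eXY : retr (adjmx X *m M *m Y) = retr (adjmx Y *m M *m X).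
  by rewrite -retr_adj !adjmxM adjmxK hM mulmxA.
have eB (Z : 'M[C]_(m, n)) : retr (adjmx Z *m M *m (X - Y)) =
    retr (adjmx Z *m M *m X) - retr (adjmx Z *m M *m Y).
  by rewrite mulmxBr; exact: retrB.
by rewrite !e (eB X) (eB Y) eXY addrA subrK.
Qed.

(** Le Cam's two-point method on square roots of the states: the overlap [f] becomes f^n on tensor
    powers, so their squared Frobenius distance is 2 - 2 f^n <= 2n (1 - f), while the acceptance gap
    1/3 bounds this distance below. *)
Lemma tpow_two_point d (A B : 'M[C]_d) (f eps : R) n (M : 'M[C]_(d ^ n)) :
  certifies (A *m adjmx A) eps n M ->
  density (A *m adjmx A) -> density (B *m adjmx B) ->
  eps <= schatten 1 (B *m adjmx B - A *m adjmx A) ->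
  \tr (A *m adjmx B) = f%:C -> 0 <= f <= 1 ->
  1 <= 72 * n%:R * (1 - f).
Proof.
move=> /certifies_retr[PM P1 h1 h2] [_ trA] dB heps trAB f01.
have {}h2 := h2 _ dB heps; case: dB => _ trB.
have hM : adjmx M = M by case: PM.
have cM := effect_contraction PM P1.
set X := tpow A n; set Y := tpow B n.
have XX : tpow (A *m adjmx A) n = X *m adjmx X by rewrite tpowM adjmx_tpow.
have YY : tpow (B *m adjmx B) n = Y *m adjmx Y by rewrite tpowM adjmx_tpow.
have fX : fnorm2 X = 1 by rewrite /fnorm2 -XX /retr mxtrace_tpow trA expr1n.
have fY : fnorm2 Y = 1 by rewrite /fnorm2 -YY /retr mxtrace_tpow trB expr1n.
have fXY : retr (X *m adjmx Y) = f ^+ n.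
  by rewrite adjmx_tpow -tpowM /retr mxtrace_tpow trAB -rmorphXn.
have fD : fnorm2 (X - Y) = 2 - 2 * f ^+ n by rewrite fnorm2B fX fY fXY; ring.
rewrite XX in h1; rewrite YY in h2.
have hdiff := retr_sandwichB X Y hM.
(* With weight 1/6 the right side of [hdiff] is at most 1/6 + 6 |X - Y|^2. A gap of 1/3 then forces
   |X - Y|^2 >= 1/36, whence the constant 72. *)
have b1 := retr_AMGM 6^-1 (adjmx X *m M) (X - Y).
have b2 := retr_AMGM 6^-1 (adjmx Y *m M) (X - Y).
have c1 := cM _ (adjmx X); have c2 := cM _ (adjmx Y).
rewrite !fnorm2_adj fX in c1; rewrite !fnorm2_adj fY in c2.
rewrite fD in b1 b2.
move: (bernoulli_compl n f01) h1 h2 hdiff b1 b2 c1 c2.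
move: (retr (M *m (X *m adjmx X))) (retr (M *m (Y *m adjmx Y))) => r1 r2.
move: (retr (adjmx X *m M *m (X - Y))) (retr (adjmx Y *m M *m (X - Y))) => u v.
move: (fnorm2 (adjmx X *m M)) (fnorm2 (adjmx Y *m M)) => g1 g2.
move: (f ^+ n) (n%:R * (1 - f)) (mulrA 72 n%:R (1 - f)) => fn w <-.
by rewrite {trA trB heps trAB XX YY fX fY fXY fD}; lra.
Qed.

(** Moving the common factor [A] to the test leaves an operator of Frobenius norm at most 1, paired
    with the sum [X] of the differences of tensor powers of [S] and [Y z]. The pairing is at least
    |I|/3, so Cauchy-Schwarz bounds |X|^2 below, and |X|^2 expands into pairwise traces. *)
Lemma tpow_ensemble d (A S : 'M[C]_d) (I : finType) (Y : I -> 'M[C]_d)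
    (eps : R) n (M : 'M[C]_(d ^ n)) :
  certifies (A *m S *m adjmx A) eps n M ->
  Defs.hermitian S -> (forall z, Defs.hermitian (Y z)) ->
  \tr (A *m adjmx A *m (A *m adjmx A)) = 1 ->
  (forall z, density (A *m Y z *m adjmx A)) ->
  (forall z, eps <= schatten 1 (A *m Y z *m adjmx A - A *m S *m adjmx A)) ->
  #|I|%:R ^+ 2 / 9 <= \sum_z \sum_z'
    complex.Re (\tr (S *m S) ^+ n - \tr (S *m Y z') ^+ n
      - \tr (Y z *m S) ^+ n + \tr (Y z *m Y z') ^+ n).
Proof.
move=> /certifies_retr[PM P1 h1 h2] hS hY trT dY hd.
have hM : adjmx M = M by case: PM.
have cM := effect_contraction PM P1.
pose B := tpow A n; pose X := \sum_z (tpow S n - tpow (Y z) n).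
have hX : adjmx X = X.
  rewrite /X adjmx_sum; apply: eq_bigr => z _.
  by rewrite adjmxB !adjmx_tpow hS hY.
have fX : fnorm2 X = \sum_z \sum_z'
    complex.Re (\tr (S *m S) ^+ n - \tr (S *m Y z') ^+ n
      - \tr (Y z *m S) ^+ n + \tr (Y z *m Y z') ^+ n).
  rewrite /fnorm2 hX {1}/X mulmx_suml retr_sum; apply: eq_bigr => z _.
  rewrite /X mulmx_sumr retr_sum; apply: eq_bigr => z' _.
  rewrite mulmxBl !mulmxBr -!tpowM /retr !linearB /= !mxtrace_tpow.
  rewrite !(ReD, ReN); ring.
rewrite -fX.
have hE Z : tpow (A *m Z *m adjmx A) n = B *m tpow Z n *m adjmx B.
  by rewrite !tpowM -adjmx_tpow.
have sumE : #|I|%:R / 3 <= retr (adjmx B *m M *m B *m X).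
  have -> : retr (adjmx B *m M *m B *m X) =
     \sum_z (retr (M *m tpow (A *m S *m adjmx A) n) -
             retr (M *m tpow (A *m Y z *m adjmx A) n)).
    rewrite /X mulmx_sumr retr_sum; apply: eq_bigr => z _.
    rewrite -retrB -mulmxBr !hE -mulmxBl -mulmxBr.
    rewrite mulmxA [RHS]retrC !mulmxA; congr retr.
  have -> : #|I|%:R / 3 = \sum_(z : I) (1 / 3 : R).
    by rewrite sumr_const -[RHS]mulr_natr mul1r mulrC.
  apply: ler_sum => z _; have := h2 _ (dY z) (hd z); move: h1.
  by move: (retr _) (retr _); clear => r1 r2; lra.
pose T := B *m adjmx B.
have hT : adjmx T = T by rewrite /T adjmxM adjmxK.
have fT : fnorm2 T = 1.
  have TE : T = tpow (A *m adjmx A) n by rewrite tpowM -adjmx_tpow.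
  by rewrite /fnorm2 hT TE -tpowM /retr mxtrace_tpow trT expr1n.
(* This norm is tr (M T M T), at most |M T|^2 = |T M|^2 <= |T|^2 = 1. *)
have fBMB : fnorm2 (adjmx B *m M *m B) <= 1.
  have -> : fnorm2 (adjmx B *m M *m B) = retr (M *m T *m (M *m T)).
    by rewrite /fnorm2 !adjmxM adjmxK hM /T !mulmxA -mulmxA retrC !mulmxA.
  have := retr_AMGM 1 (M *m T) (M *m T).
  have -> : fnorm2 (M *m T) = fnorm2 (T *m M).
    by rewrite -fnorm2_adj adjmxM hM hT.
  have := cM _ T; rewrite fT; move: (fnorm2 _) (retr _); clear => r1 r2; lra.
have := retr_AMGM (#|I|%:R / 3) (adjmx B *m M *m B) X.
have N0 : 0 <= #|I|%:R :> R by [].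
move: sumE fBMB; move: (retr _) (fnorm2 X) (fnorm2 _) N0; clear.
by move: (#|I|%:R) => N r x g N0 h1 h2; nra.
Qed.

End TensorPowers.

(** * The Schatten-1/2 quasinorm of a diagonal matrix *)

Section SchattenHalf.
Variable R : realType.
Local Notation C := R[i].

Lemma char_poly_unitary_diag n (U : 'M[C]_n) (r : 'rV[C]_n) :
  U \is unitarymx ->
  char_poly (U *m diag_mx r *m adjmx U) = \prod_i ('X - (r 0 i)%:P).
Proof.
move=> hU; rewrite /char_poly /char_poly_mx.
have e1 : map_mx polyC U *m map_mx polyC (adjmx U) = 1%:M.
  by rewrite -map_mxM unitaryV // map_mx1.
have -> : 'X%:M - map_mx polyC (U *m diag_mx r *m adjmx U) =
  map_mx polyC U *m ('X%:M - map_mx polyC (diag_mx r)) *m map_mx polyC (adjmx U).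
  rewrite !map_mxM mulmxBr mulmxBl; congr (_ - _).
  by rewrite scalar_mxC -mulmxA e1 mulmx1.
rewrite !det_mulmx mulrAC -det_mulmx e1 det1 mul1r.
have -> : 'X%:M - map_mx polyC (diag_mx r) = diag_mx (\row_i ('X - (r 0 i)%:P)).
  apply/matrixP => i j; rewrite !mxE; case: (eqVneq i j) => _ //=.
  by rewrite !mulr0n polyC0 subr0.
by rewrite det_diag; apply: eq_bigr => i _; rewrite mxE.
Qed.

(** Both sides have the same characteristic polynomial, and a split polynomial determines its roots
    with multiplicity. *)
Lemma diag_unitary_perm n (U : 'M[C]_n) (r1 r2 : 'I_n -> C) :
  U \is unitarymx ->
  diag_mx (\row_i r1 i) = U *m diag_mx (\row_i r2 i) *m adjmx U ->
  perm_eq [seq r1 i | i <- enum 'I_n] [seq r2 i | i <- enum 'I_n].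
Proof.
move=> hU e.
have h1 : (1%:M : 'M[C]_n) \is unitarymx.
  by apply/unitarymxP; rewrite -/(adjmx _) adjmx1 mulmx1.
have c1 := char_poly_unitary_diag (\row_i r1 i) h1.
rewrite adjmx1 mulmx1 mul1mx e (char_poly_unitary_diag _ hU) in c1.
have bE (f : 'I_n -> C) :
    \prod_i ('X - ((\row_i f i : 'rV[C]_n) 0 i)%:P) =
    \prod_(x <- [seq f i | i <- enum 'I_n]) ('X - x%:P).
  by rewrite big_map big_enum; apply: eq_bigr => i _; rewrite mxE.
by rewrite !bE in c1; rewrite perm_sym; apply: prod_XsubC_eq.
Qed.

(** Whichever singular value decomposition [xget] picks, multiplying [X] by its adjoint removes [V]
    and makes diag(mu^2) unitarily similar to diag(s^2). So the squares agree as multisets. In the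
    default branch the value is 0. *)
Lemma schatten_half_diag_le n (mu : 'I_n -> R) : (forall i, 0 <= mu i) ->
  schatten (1 / 2%:R) (diag_mx (\row_i (mu i)%:C) : 'M[C]_n)
    <= (\sum_i Num.sqrt (mu i)) ^+ 2.
Proof.
move=> mu0; rewrite /schatten; case: xgetP => [t _|_]; last exact: sqr_ge0.
move=> [U [V [s [hU hV s0 XE ->]]]].
have sq (f : 'I_n -> R) : (forall i, 0 <= f i) ->
    powR (\sum_i powR (f i) (1 / 2)) (1 / 2)^-1 = (\sum_i Num.sqrt (f i)) ^+ 2.
  move=> f0; rewrite div1r invrK powR_mulrn; last first.
    by apply: sumr_ge0 => i _; exact: powR_ge0.
  by congr (_ ^+ 2); apply: eq_bigr => i _; rewrite powR12_sqrt.
rewrite sq //.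
suff -> : \sum_i Num.sqrt (s i) = \sum_i Num.sqrt (mu i) by [].
have adjd (f : 'I_n -> R) : adjmx (diag_mx (\row_i (f i)%:C) : 'M[C]_n) =
    diag_mx (\row_i (f i)%:C).
  apply/matrixP => i j; rewrite adjmxE !mxE eq_sym.
  by case: eqP => [->|_]; rewrite ?mulr1n ?mulr0n /= ?oppr0.
have dd (f : 'I_n -> R) : (diag_mx (\row_i (f i)%:C) : 'M[C]_n) *m
    diag_mx (\row_i (f i)%:C) = diag_mx (\row_i (f i ^+ 2)%:C).
  apply/matrixP => i j; rewrite mul_diag_mx !mxE.
  by case: eqP => _; rewrite ?mulr1n ?mulr0n ?mulr0 // -rmorphM.
have e1 : diag_mx (\row_i (mu i ^+ 2)%:C) =
    U *m diag_mx (\row_i (s i ^+ 2)%:C) *m adjmx U :> 'M[C]_n.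
  have sE : U *m diag_mx (\row_i (s i)%:C) *m adjmx V *m
      adjmx (U *m diag_mx (\row_i (s i)%:C) *m adjmx V) =
      U *m diag_mx (\row_i (s i)%:C) *m diag_mx (\row_i (s i)%:C) *m adjmx U.
    move: (adjd s); move: (diag_mx _) => D hD.
    rewrite !adjmxM adjmxK hD !mulmxA; congr (_ *m _ *m _).
    exact: mulmx_unitaryK.
  by rewrite -(dd mu) -(dd s) -{2}(adjd mu) XE sE !mulmxA.
have peq := diag_unitary_perm hU e1.
(* The sum is written as a function of the list of squares, which is what [peq] permutes; hence the
   iterated root. *)
have fin (f : 'I_n -> R) : (forall i, 0 <= f i) ->
  \sum_i Num.sqrt (f i) = \sum_(x <- [seq (f i ^+ 2)%:C | i <- enum 'I_n])
     Num.sqrt (Num.sqrt (complex.Re x)).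
  move=> f0; rewrite big_map big_enum; apply: eq_bigr => i _.
  by rewrite /= sqrtr_sqr ger0_norm.
by rewrite fin // [RHS]fin // [RHS](perm_big _ peq).
Qed.

End SchattenHalf.

(** * Real perturbations of a spectrum *)

Section RealMatrices.
Variable R : realType.
Local Notation C := R[i].

Definition cplx m n (A : 'M[R]_(m, n)) : 'M[C]_(m, n) :=
  map_mx (real_complex R) A.

Definition dmx n (f : 'I_n -> R) : 'M[R]_n := diag_mx (\row_i f i).

Lemma dmxE n (f : 'I_n -> R) i j : dmx f i j = f i *+ (i == j).
Proof. by rewrite !mxE; case: eqP => [->|]. Qed.

Lemma dmx_tr n (f : 'I_n -> R) : (dmx f)^T = dmx f.
Proof. by rewrite /dmx tr_diag_mx. Qed.

Lemma dmxM n (f g : 'I_n -> R) : dmx f *m dmx g = dmx (fun i => f i * g i).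
Proof.
apply/matrixP => i j; rewrite mul_diag_mx mxE (mxE _ _ 0 i) !dmxE.
by rewrite mulrnAr.
Qed.

Lemma mul_dmx n (f : 'I_n -> R) (A : 'M[R]_n) i j :
  (dmx f *m A) i j = f i * A i j.
Proof. by rewrite mul_diag_mx !mxE. Qed.

Lemma mxtrace_dmx n (f : 'I_n -> R) : \tr (dmx f) = \sum_i f i.
Proof. by rewrite mxtrace_diag; apply: eq_bigr => i _; rewrite mxE. Qed.

Lemma mxtrace_mulE m n (A : 'M[R]_(m, n)) (B : 'M[R]_(n, m)) :
  \tr (A *m B) = \sum_i \sum_j A i j * B j i.
Proof. by apply: eq_bigr => i _; rewrite mxE. Qed.

Lemma cplxM m n p (A : 'M[R]_(m, n)) (B : 'M[R]_(n, p)) :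
  cplx (A *m B) = cplx A *m cplx B.
Proof. exact: map_mxM. Qed.

Lemma cplxD m n (A B : 'M[R]_(m, n)) : cplx (A + B) = cplx A + cplx B.
Proof. exact: map_mxD. Qed.

Lemma cplxB m n (A B : 'M[R]_(m, n)) : cplx (A - B) = cplx A - cplx B.
Proof. exact: map_mxB. Qed.

Lemma adjmx_cplx m n (A : 'M[R]_(m, n)) : adjmx (cplx A) = cplx A^T.
Proof. by apply/matrixP => i j; rewrite adjmxE !mxE /= oppr0. Qed.

Lemma mxtrace_cplx n (A : 'M[R]_n) : \tr (cplx A) = (\tr A)%:C.
Proof. by rewrite /mxtrace rmorph_sum; apply: eq_bigr => i _; rewrite mxE. Qed.

Lemma cplx_dmx n (f : 'I_n -> R) : cplx (dmx f) = diag_mx (\row_i (f i)%:C).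
Proof. by apply/matrixP => i j; rewrite !mxE rmorphMn. Qed.

Lemma psd_cplx_gram m n (B : 'M[R]_(m, n)) : psd (cplx (B *m B^T)).
Proof. by rewrite cplxM -adjmx_cplx; exact: psd_mul_adj. Qed.

Lemma psd_cplx_dmx n (f : 'I_n -> R) : (forall i, 0 <= f i) ->
  psd (cplx (dmx f)).
Proof.
move=> f0; have -> : dmx f = dmx (fun i => Num.sqrt (f i)) *m
    (dmx (fun i => Num.sqrt (f i)))^T.
  rewrite dmx_tr dmxM; congr (diag_mx _); apply/rowP => i.
  by rewrite !mxE -expr2 sqr_sqrtr.
exact: psd_cplx_gram.
Qed.

(** The loss of squared norm under [W] is the trace of X (1 - W^2) X^*, and 1 - W^2 is a nonnegative
    diagonal matrix. *)
Lemma sym_contraction n (W : 'M[R]_n) (P : 'I_n -> R) :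
  W^T = W -> W *m W = dmx P -> (forall i, P i <= 1) -> contraction (cplx W).
Proof.
move=> hW hP P1 m X.
have p1 : psd (cplx (dmx (fun i => 1 - P i))).
  by apply: psd_cplx_dmx => i; rewrite subr_ge0.
have := psd_retr_ge0 X p1.
have -> : cplx (dmx (fun i => 1 - P i)) = 1%:M - cplx (W *m W).
  rewrite hP; apply/matrixP => i j; rewrite !mxE.
  by case: eqP => [->|_]; rewrite ?mulr0n ?subr0 // !mulr1n rmorphB.
have -> : retr (X *m (1%:M - cplx (W *m W)) *m adjmx X) =
    fnorm2 X - fnorm2 (X *m cplx W).
  rewrite /fnorm2 adjmxM adjmx_cplx hW mulmxBr mulmxBl mulmx1 cplxM !mulmxA.
  exact: retrB.
by rewrite subr_ge0.
Qed.

Lemma conj_contraction n (U K : 'M[C]_n) : U \is unitarymx -> contraction K ->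
  contraction (U *m K *m adjmx U).
Proof.
move=> hU hK; apply: contractionM; last exact/unitary_contraction/unitary_adj.
by apply: contractionM => //; exact: unitary_contraction.
Qed.

Lemma adjmx_conj n (U : 'M[C]_n) (X : 'M[R]_n) :
  adjmx (U *m cplx X *m adjmx U) = U *m cplx X^T *m adjmx U.
Proof. by rewrite !adjmxM adjmxK adjmx_cplx mulmxA. Qed.

Lemma conjM n (U : 'M[C]_n) (X Y : 'M[R]_n) : U \is unitarymx ->
  (U *m cplx X *m adjmx U) *m (U *m cplx Y *m adjmx U) =
  U *m cplx (X *m Y) *m adjmx U.
Proof.
move=> hU; rewrite cplxM !mulmxA; congr (_ *m _ *m _).
exact: mulmx_unitaryK.
Qed.

Lemma mxtrace_conj n (U : 'M[C]_n) (X : 'M[R]_n) : U \is unitarymx ->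
  \tr (U *m cplx X *m adjmx U) = (\tr X)%:C.
Proof.
by move=> hU; rewrite mxtrace_mulC mulmxA unitaryVl // mul1mx mxtrace_cplx.
Qed.

Lemma conjB n (U : 'M[C]_n) (X Y : 'M[R]_n) :
  U *m cplx X *m adjmx U - U *m cplx Y *m adjmx U =
  U *m cplx (X - Y) *m adjmx U.
Proof. by rewrite cplxB mulmxBr mulmxBl. Qed.

Lemma cplx_gram n (U : 'M[C]_n) (X : 'M[R]_n) :
  (U *m cplx X) *m adjmx (U *m cplx X) = U *m cplx (X *m X^T) *m adjmx U.
Proof. by rewrite adjmxM adjmx_cplx cplxM !mulmxA. Qed.

Lemma schatten1_conj_ge n (U : 'M[C]_n) (X W : 'M[R]_n) (P : 'I_n -> R) :
  U \is unitarymx -> X^T = X ->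
  W^T = W -> W *m W = dmx P -> (forall i, P i <= 1) ->
  \tr (X *m W) <= schatten 1 (U *m cplx X *m adjmx U).
Proof.
move=> hU hX hW hP P1.
have hc := conj_contraction hU (sym_contraction hW hP P1).
have hh : Defs.hermitian (U *m cplx X *m adjmx U).
  by rewrite /Defs.hermitian adjmx_conj hX.
apply: le_trans (retr_le_schatten1 hh hc).
by rewrite conjM // /retr mxtrace_conj.
Qed.

(** The competitor is [B *m B^T] in the eigenbasis, [W] is a dual witness for its trace distance to
    sigma, and [f] is the overlap of [B] with the square root of sigma. *)
Lemma real_two_point d (U : 'M[C]_d) (lam : 'I_d -> R) (B W : 'M[R]_d)
    (P : 'I_d -> R) (eps : R) n (M : 'M[C]_(d ^ n)) :
  U \is unitarymx -> (forall i, 0 <= lam i) -> \sum_i lam i = 1 ->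
  certifies (U *m cplx (dmx lam) *m adjmx U) eps n M ->
  \tr (B *m B^T) = 1 ->
  W^T = W -> W *m W = dmx P -> (forall i, P i <= 1) ->
  eps <= \tr ((B *m B^T - dmx lam) *m W) ->
  let f := \sum_i Num.sqrt (lam i) * B i i in
  0 <= f <= 1 -> 1 <= 72 * n%:R * (1 - f).
Proof.
move=> hU lam0 lam1 hc trB hW hP P1 he f f01.
pose r i := Num.sqrt (lam i).
have AA : U *m cplx (dmx lam) *m adjmx U =
    (U *m cplx (dmx r)) *m adjmx (U *m cplx (dmx r)).
  rewrite cplx_gram dmx_tr dmxM; congr (_ *m cplx _ *m _); congr (diag_mx _); apply/rowP => i.
  by rewrite !mxE -expr2 sqr_sqrtr.
have BB : U *m cplx (B *m B^T) *m adjmx U =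
    (U *m cplx B) *m adjmx (U *m cplx B).
  by rewrite cplx_gram.
have dA : density ((U *m cplx (dmx r)) *m adjmx (U *m cplx (dmx r))).
  split; first exact: psd_mul_adj.
  by rewrite -AA mxtrace_conj // mxtrace_dmx lam1.
have dB : density ((U *m cplx B) *m adjmx (U *m cplx B)).
  split; first exact: psd_mul_adj.
  by rewrite -BB mxtrace_conj // trB.
have he' : eps <= schatten 1 ((U *m cplx B) *m adjmx (U *m cplx B) -
    (U *m cplx (dmx r)) *m adjmx (U *m cplx (dmx r))).
  rewrite -AA -BB conjB; apply: le_trans he _.
  apply: (schatten1_conj_ge hU _ hW hP P1).
  by rewrite linearB /= trmx_mul trmxK dmx_tr.
have tAB : \tr ((U *m cplx (dmx r)) *m adjmx (U *m cplx B)) = f%:C.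
  rewrite adjmxM adjmx_cplx mulmxA -(mulmxA U) -cplxM.
  rewrite mxtrace_conj //; congr (_%:C).
  by apply: eq_bigr => i _; rewrite mul_dmx mxE.
by rewrite AA in hc; exact: (tpow_two_point hc dA dB he' tAB f01).
Qed.

(** Rotating only the dominant eigenvector by an angle of order eps moves the state by order eps in
    trace norm but costs only order eps^2 in overlap. *)
Lemma certifies_pure_like d (U : 'M[C]_d) (lam : 'I_d -> R)
    (eps : R) n (M : 'M[C]_(d ^ n)) (i1 i2 : 'I_d) :
  U \is unitarymx -> (forall i, 0 <= lam i) -> \sum_i lam i = 1 ->
  0 < eps -> eps < 1 / 12%:R ->
  certifies (U *m cplx (dmx lam) *m adjmx U) eps n M ->
  i1 != i2 -> 3 / 4 <= lam i1 ->
  1 <= 144 * n%:R * eps ^+ 2.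
Proof.
move=> hU lam0 lam1 e0 e1 hc i12 hl.
have l1 : lam i1 <= 1.
  by rewrite -lam1 (bigD1 i1) //= lerDl sumr_ge0.
(* Rational parametrization of the circle: [c] and [s] are the cosine and sine of the angle whose
   half has tangent eps. *)
pose D := (1 + eps ^+ 2)^-1.
have D0 : 0 < D by rewrite invr_gt0; nra.
have DE : D * (1 + eps ^+ 2) = 1 by rewrite mulVf //; nra.
pose c := (1 - eps ^+ 2) * D; pose s := 2 * eps * D.
have cs : c ^+ 2 + s ^+ 2 = 1.
  have -> : c ^+ 2 + s ^+ 2 = (D * (1 + eps ^+ 2)) ^+ 2 by rewrite /c /s; ring.
  by rewrite DE expr1n.
have sc : eps <= 2 * lam i1 * (s * c).
  have -> : 2 * lam i1 * (s * c) =
      eps * (4 * lam i1 * (1 - eps ^+ 2) * D ^+ 2) by rewrite /s /c; ring.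
  have D1 : D <= 1 by nra.
  have D2 : 9 / 10 <= D by nra.
  rewrite ler_peMr ?ltW //.
  have : 81 / 100 <= D ^+ 2 by nra.
  have : 9 / 10 <= 1 - eps ^+ 2 by nra.
  move: (D ^+ 2) (1 - eps ^+ 2) => x y hy hx.
  have : 81 / 100 * (9 / 10) <= x * y by nra.
  by move=> hxy; rewrite -mulrA (mulrC y); nra.
have c1 : 1 - c <= 2 * eps ^+ 2.
  have -> : 1 - c = 2 * eps ^+ 2 * D by rewrite /c -{1}DE; ring.
  by rewrite ler_piMr; nra.
have c0 : 0 <= c <= 1.
  by apply/andP; split; [rewrite /c; nra | nra].
pose f1 := Num.sqrt (lam i1).
have f1E : f1 * f1 = lam i1 by rewrite -expr2 sqr_sqrtr.
pose v i : R := c * (i == i1)%:R + s * (i == i2)%:R.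
pose w i : R := v i - (i == i1)%:R.
(* This is the square root of the diagonal with column [i1] replaced by [f1] times the rotated unit
   vector [v]. *)
pose B : 'M[R]_d := \matrix_(i, k)
  (Num.sqrt (lam k) * (i == k)%:R + (k == i1)%:R * (f1 * w i)).
have pick (F : 'I_d -> R) j : \sum_k F k * (k == j)%:R = F j.
  rewrite (bigD1 j) //= eqxx mulr1 big1 ?addr0 // => k /negbTE ->.
  by rewrite mulr0.
have BBE i j : (B *m B^T) i j = lam i * (i == j)%:R +
    lam i1 * (v i * v j - (i == i1)%:R * (j == i1)%:R).
  rewrite mxE; under eq_bigr do rewrite !mxE.
  have -> : \sum_k (Num.sqrt (lam k) * (i == k)%:R + (k == i1)%:R * (f1 * w i)) *
     (Num.sqrt (lam k) * (j == k)%:R + (k == i1)%:R * (f1 * w j)) =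
     \sum_k (lam k * (j == k)%:R) * (k == i)%:R +
     \sum_k (Num.sqrt (lam k) * (f1 * w j) * (k == i)%:R) * (k == i1)%:R +
     \sum_k (Num.sqrt (lam k) * (f1 * w i) * (k == j)%:R) * (k == i1)%:R +
     \sum_k (f1 * w i * (f1 * w j)) * (k == i1)%:R.
    rewrite -!big_split /=; apply: eq_bigr => k _.
    rewrite (eq_sym i k) (eq_sym j k).
    have e2 : (k == i1)%:R * (k == i1)%:R = (k == i1)%:R :> R.
      by case: eqP => _; rewrite ?mulr0 ?mulr1.
    have e3 : Num.sqrt (lam k) * Num.sqrt (lam k) = lam k.
      by rewrite -expr2 sqr_sqrtr.
    move: e3 e2; move: (lam k) (Num.sqrt (lam k)) => l q <-.
    by case: (k == i1) => _ /=; ring.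
  rewrite !pick (eq_sym j i) (eq_sym i1 i) (eq_sym i1 j) -/f1 -f1E /w; ring.
have trB : \tr (B *m B^T) = 1.
  rewrite /mxtrace; under eq_bigr do rewrite BBE eqxx.
  rewrite big_split /= -mulr_sumr.
  have -> : \sum_i lam i * true%:R = 1.
    by rewrite -[RHS]lam1; apply: eq_bigr => i _; rewrite mulr1.
  have -> : \sum_i (v i * v i - (i == i1)%:R * (i == i1)%:R) =
     \sum_i (c * c * (i == i1)%:R) * (i == i1)%:R +
     \sum_i (2 * c * s * (i == i1)%:R) * (i == i2)%:R +
     \sum_i (s * s * (i == i2)%:R) * (i == i2)%:R -
     \sum_i (i == i1)%:R * (i == i1)%:R.
    rewrite -!big_split -sumrB /=; apply: eq_bigr => i _; rewrite /v; ring.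
  rewrite !pick !eqxx (eq_sym i2 i1) (negbTE i12).
  have -> : c * c * true%:R + 2 * c * s * false%:R + s * s * true%:R - true%:R =
      c ^+ 2 + s ^+ 2 - 1 by rewrite /=; ring.
  by rewrite cs subrr mulr0 addr0.
(* The swap of the two coordinates reads off twice the off-diagonal entry, 2 lam_(i1) s c. *)
pose W : 'M[R]_d := delta_mx i1 i2 + delta_mx i2 i1.
have hW : W^T = W by rewrite /W linearD /= !trmx_delta addrC.
pose P i : R := (i == i1)%:R + (i == i2)%:R.
have hP : W *m W = dmx P.
  rewrite /W mulmxDl !mulmxDr !mul_delta_mx_cond (eq_sym i2 i1) (negbTE i12).
  rewrite !eqxx !mulr0n !mulr1n add0r addr0.
  apply/matrixP => i j; rewrite dmxE !mxE /P.
  case: (eqVneq i j) => [<-|ij].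
    by rewrite mulr1n !andbb.
  rewrite mulr0n; case: (eqVneq i i1) => [ii|]; case: (eqVneq i i2) => [ii'|] //=;
    rewrite ?addr0 ?add0r //.
  - by move: i12; rewrite -ii -ii' eqxx.
  - by rewrite -ii (eq_sym j i) (negbTE ij).
  - by rewrite -ii' (eq_sym j i) (negbTE ij).
have P1 i : P i <= 1.
  rewrite /P; case: (eqVneq i i1) => [->|_]; first by rewrite (negbTE i12) addr0.
  by rewrite add0r lern1 leq_b1.
have tW (X : 'M[R]_d) : \tr (X *m W) = X i2 i1 + X i1 i2.
  rewrite /W mulmxDr linearD /= !mxtrace_mulE; congr (_ + _).
    rewrite (bigD1 i2) //= (bigD1 i1) //= !mxE !eqxx mulr1 big1 ?big1 ?addr0 //.
      move=> i /negbTE hi; rewrite big1 // => j _; rewrite !mxE hi.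
      by rewrite andbF mulr0.
    by move=> j /negbTE hj; rewrite !mxE hj mulr0.
  rewrite (bigD1 i1) //= (bigD1 i2) //= !mxE !eqxx mulr1 big1 ?big1 ?addr0 //.
    move=> i /negbTE hi; rewrite big1 // => j _; rewrite !mxE hi.
    by rewrite andbF mulr0.
  by move=> j /negbTE hj; rewrite !mxE hj mulr0.
have he : eps <= \tr ((B *m B^T - dmx lam) *m W).
  rewrite tW !mxE -!/((B *m B^T) _ _).
  have e21 := BBE i2 i1; have e12 := BBE i1 i2.
  rewrite !mxE in e21 e12; rewrite e21 e12 /v !eqxx (eq_sym i2 i1) (negbTE i12).
  rewrite /= !mulr0n !(mulr0, mulr1, addr0, add0r, subr0); nra.
have fE : \sum_i Num.sqrt (lam i) * B i i = 1 - lam i1 * (1 - c).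
  have -> : \sum_i Num.sqrt (lam i) * B i i =
      \sum_i lam i + \sum_i (Num.sqrt (lam i) * (f1 * w i)) * (i == i1)%:R.
    rewrite -big_split /=; apply: eq_bigr => i _; rewrite mxE eqxx.
    have e3 : Num.sqrt (lam i) * Num.sqrt (lam i) = lam i.
      by rewrite -expr2 sqr_sqrtr.
    by move: e3; move: (lam i) (Num.sqrt (lam i)) => l q <- /=; ring.
  rewrite pick lam1 -/f1 /w /v eqxx (negbTE i12) mulr1 mulr0 addr0.
  by rewrite mulrA f1E /=; ring.
have := real_two_point hU lam0 lam1 hc trB hW hP P1 he.
rewrite fE => hh.
have N0 : 0 <= n%:R :> R by [].
case/andP: c0 => c0 c0'.
have h1 : 1 <= 72 * n%:R * (1 - (1 - lam i1 * (1 - c))).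
  by apply: hh; apply/andP; split; nra.
have : lam i1 * (1 - c) <= 2 * eps ^+ 2 by nra.
by move=> h2; nra.
Qed.

End RealMatrices.

(** * Two-point and second-moment bounds *)

Section TwoPoint.
Variable R : realType.
Local Notation C := R[i].

Lemma sqrt_ge_taylor (x : R) : -1 <= x -> x <= 1 ->
  1 + x / 2 - x ^+ 2 / 2 <= Num.sqrt (1 + x).
Proof.
move=> h0 h1; have h : 0 <= 1 + x by lra.
have := sqr_sqrtr h; have := sqrtr_ge0 (1 + x).
move: (Num.sqrt _) => s s0 s2; rewrite leNgt; apply/negP => lt.
have : s ^+ 2 < (1 + x / 2 - x ^+ 2 / 2) ^+ 2 by nra.
have -> : (1 + x / 2 - x ^+ 2 / 2) ^+ 2 =
  1 + x - x ^+ 2 * (3 / 4 + x / 2 - x ^+ 2 / 4) by field.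
have : 0 <= x ^+ 2 * (3 / 4 + x / 2 - x ^+ 2 / 4).
  by apply: mulr_ge0; [exact: sqr_ge0 | nra].
lra.
Qed.

Lemma sqrt_le_taylor (x : R) : -1 <= x -> Num.sqrt (1 + x) <= 1 + x / 2.
Proof.
move=> h0; have h : 0 <= 1 + x by lra.
have := sqr_sqrtr h; have := sqrtr_ge0 (1 + x).
by move: (Num.sqrt _) => s s0 s2; have := sqr_ge0 (s - 1); nra.
Qed.

(* With partial sums [c_i], the weight [h_i = c_i + c_{i+1} - 1] is centred and
   its second moment telescopes: [int_0^1 (2x-1)^2 dx = 1/3]. *)
Lemma centred_weight d (lam : 'I_d -> R) :
  (forall i, 0 <= lam i) -> \sum_i lam i = 1 ->
  exists h : 'I_d -> R, [/\ forall i, -1 <= h i <= 1,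
    \sum_i lam i * h i = 0 &
    \sum_i lam i * h i ^+ 2 = (1 - \sum_i lam i ^+ 3) / 3].
Proof.
move=> lam0 lam1.
pose g m : R := \sum_(k < d | (k < m)%N) lam k.
have g0 : g 0%N = 0 by rewrite /g big_pred0.
have gd : g d = 1.
  by rewrite -lam1 /g; apply: eq_bigl => k; rewrite ltn_ord.
have gS (i : 'I_d) : g i.+1 = g i + lam i.
  rewrite /g (bigD1 i) //= addrC; congr (_ + _).
  apply: eq_bigl => k; rewrite ltnS leq_eqVlt.
  rewrite -(inj_eq val_inj) /=.
  by case: ltngtP => //=.
have tele (G : R -> R) : \sum_(i < d) (G (g i.+1) - G (g i)) = G 1 - G 0.
  rewrite -gd -[in G 0]g0.
  by rewrite -(big_mkord xpredT (fun i => G (g i.+1) - G (g i))) telescope_sumr.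
exists (fun i : 'I_d => 2 * g i + lam i - 1); split.
- move=> i.
  have a : 0 <= g i by rewrite sumr_ge0.
  have b : g i + lam i <= 1.
    by rewrite -gS -lam1 /g [leRHS](bigID (fun k : 'I_d => (k < i.+1)%N)) /= lerDl sumr_ge0.
  by have := lam0 i; lra.
- have := tele (fun x => x ^+ 2).
  under eq_bigr => i _ do rewrite gS.
  rewrite expr1n expr0n /= subr0 => e.
  have -> : \sum_i lam i * (2 * g i + lam i - 1) =
     \sum_(i < d) ((g i + lam i) ^+ 2 - g i ^+ 2) - \sum_i lam i.
    by rewrite -sumrB; apply: eq_bigr => i _; ring.
  by rewrite e lam1 subrr.
- have := tele (fun x => (2 * x - 1) ^+ 3 / 6).
  under eq_bigr => i _ do rewrite gS.
  move=> e.
  have -> : \sum_i lam i * (2 * g i + lam i - 1) ^+ 2 =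
     \sum_(i < d) ((2 * (g i + lam i) - 1) ^+ 3 / 6 - (2 * g i - 1) ^+ 3 / 6)
       - (\sum_i lam i ^+ 3) / 3.
    by rewrite mulr_suml -sumrB; apply: eq_bigr => i _; field.
  by rewrite e; field.
Qed.

(** The competitor is the commuting state with eigenvalues lam_i (1 + t h_i), where [h] is centred
    and bounded by 1. Without a dominant eigenvalue [h] has variance bounded below, so [h] itself
    witnesses the distance. *)
Lemma certifies_spread d (U : 'M[C]_d) (lam : 'I_d -> R)
    (eps : R) n (M : 'M[C]_(d ^ n)) :
  U \is unitarymx -> (forall i, 0 <= lam i) -> \sum_i lam i = 1 ->
  0 < eps -> eps < 1 / 12%:R ->
  certifies (U *m cplx (dmx lam) *m adjmx U) eps n M ->
  (forall i, lam i < 3 / 4) ->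
  1 <= 1764 * n%:R * eps ^+ 2.
Proof.
move=> hU lam0 lam1 e0 e1 hc hl.
have [h [hb hm hv]] := centred_weight lam0 lam1.
(* Since lam_i^3 <= (9/16) lam_i, the variance is at least (1 - 9/16) / 3. *)
have v1 : 7 / 48 <= \sum_i lam i * h i ^+ 2.
  rewrite hv.
  have : \sum_i lam i ^+ 3 <= \sum_i (9 / 16) * lam i.
    apply: ler_sum => i _; have a := lam0 i; have b := hl i.
    rewrite exprSr ler_wpM2r //; nra.
  by rewrite -mulr_sumr lam1; lra.
have v2 : \sum_i lam i * h i ^+ 2 <= 1.
  rewrite -lam1; apply: ler_sum => i _; rewrite ler_piMr //.
  by have /andP[] := hb i; nra.
(* The distance is then at least 7 eps * 7/48 > eps, and |t h_i| < 1. The overlap loss is at most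
   t^2 / 2, which yields 72 * 49 / 2 = 1764. *)
pose t := 7 * eps.
have tb i : -1 <= t * h i <= 1 by rewrite /t; have /andP[] := hb i; nra.
pose B := dmx (fun i => Num.sqrt (lam i) * Num.sqrt (1 + t * h i)).
have BB : B *m B^T = dmx (fun i => lam i * (1 + t * h i)).
  rewrite /B dmx_tr dmxM; congr (diag_mx _); apply/rowP => i; rewrite !mxE.
  rewrite mulrACA -!expr2 !sqr_sqrtr //.
  by have /andP[] := tb i; lra.
have trB : \tr (B *m B^T) = 1.
  rewrite BB mxtrace_dmx.
  have -> : \sum_i lam i * (1 + t * h i) =
      \sum_i lam i + t * \sum_i lam i * h i.
    by rewrite mulr_sumr -big_split; apply: eq_bigr => i _ /=; ring.
  by rewrite hm lam1 mulr0 addr0.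
have he : eps <= \tr ((B *m B^T - dmx lam) *m dmx h).
  rewrite BB mulmxBl !dmxM linearB /= !mxtrace_dmx -sumrB.
  have -> : \sum_i (lam i * (1 + t * h i) * h i - lam i * h i) =
      t * \sum_i lam i * h i ^+ 2.
    by rewrite mulr_sumr; apply: eq_bigr => i _ /=; ring.
  by rewrite /t; nra.
have P1 i : h i * h i <= 1 by have /andP[] := hb i; nra.
have := real_two_point hU lam0 lam1 hc trB (dmx_tr h) (dmxM h h) P1 he.
have fE : \sum_i Num.sqrt (lam i) * B i i =
    \sum_i lam i * Num.sqrt (1 + t * h i).
  apply: eq_bigr => i _; rewrite /B dmxE eqxx mulr1n mulrA -expr2.
  by rewrite sqr_sqrtr.
rewrite /= fE.
have f1 : \sum_i lam i * Num.sqrt (1 + t * h i) <= 1.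
  have : \sum_i lam i * Num.sqrt (1 + t * h i) <=
      \sum_i lam i * (1 + t * h i / 2).
    apply: ler_sum => i _; apply: ler_wpM2l => //.
    by apply: sqrt_le_taylor; have /andP[] := tb i.
  have -> : \sum_i lam i * (1 + t * h i / 2) =
      \sum_i lam i + t / 2 * \sum_i lam i * h i.
    by rewrite mulr_sumr -big_split; apply: eq_bigr => i _ /=; ring.
  by rewrite hm lam1 mulr0 addr0.
have f2 : 1 - t ^+ 2 / 2 <= \sum_i lam i * Num.sqrt (1 + t * h i).
  have : \sum_i lam i * (1 + t * h i / 2 - (t * h i) ^+ 2 / 2) <=
      \sum_i lam i * Num.sqrt (1 + t * h i).
    apply: ler_sum => i _; apply: ler_wpM2l => //.
    by apply: sqrt_ge_taylor; have /andP[] := tb i.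
  have -> : \sum_i lam i * (1 + t * h i / 2 - (t * h i) ^+ 2 / 2) =
      \sum_i lam i + t / 2 * \sum_i lam i * h i
        - t ^+ 2 / 2 * \sum_i lam i * h i ^+ 2.
    rewrite !mulr_sumr -big_split -sumrB; apply: eq_bigr => i _ /=; ring.
  rewrite hm lam1 mulr0 addr0; move: (\sum_i lam i * Num.sqrt _) => f.
  by have := sqr_ge0 t; nra.
have f0 : 0 <= \sum_i lam i * Num.sqrt (1 + t * h i).
  by apply: sumr_ge0 => i _; rewrite mulr_ge0 ?sqrtr_ge0.
rewrite f0 f1 => /(_ isT); move: f2.
have N0 : 0 <= n%:R :> R by [].
rewrite /t; move: (\sum_i _) => f h1; nra.
Qed.

Lemma certifies_universal d (U : 'M[C]_d) (lam : 'I_d -> R)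
    (eps : R) n (M : 'M[C]_(d ^ n)) :
  (2 <= d)%N ->
  U \is unitarymx -> (forall i, 0 <= lam i) -> \sum_i lam i = 1 ->
  0 < eps -> eps < 1 / 12%:R ->
  certifies (U *m cplx (dmx lam) *m adjmx U) eps n M ->
  1 <= 1764 * n%:R * eps ^+ 2.
Proof.
move=> d2 hU lam0 lam1 e0 e1 hc.
case: (boolP [forall i, lam i < 3 / 4]) => [/forallP hl|].
  exact: certifies_spread hc hl.
rewrite negb_forall => /existsP[i1]; rewrite -leNgt => hl.
have [i2 i12] : exists i2 : 'I_d, i1 != i2.
  case: (eqVneq (i1 : nat) 0%N) => [e|e].
    by exists (Ordinal d2); rewrite -(inj_eq val_inj) /= e.
  by exists (Ordinal (ltnW d2)); rewrite -(inj_eq val_inj).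
have := certifies_pure_like hU lam0 lam1 e0 e1 hc i12 hl.
have : 0 <= n%:R * eps ^+ 2 by rewrite mulr_ge0 ?sqr_ge0.
by rewrite -!mulrA; lra.
Qed.

End TwoPoint.

(** * Random sign perturbations and their second moment *)

Section Ensemble.
Variable R : realType.
Local Notation C := R[i].

Definition sg d (z : {ffun 'I_d -> bool}) (i : 'I_d) : R := (-1) ^+ z i.

Lemma sg2 d (z : {ffun 'I_d -> bool}) i : sg z i * sg z i = 1.
Proof. by rewrite /sg; case: (z i); rewrite ?expr1 ?expr0; ring. Qed.

Definition xorf d (z w : {ffun 'I_d -> bool}) : {ffun 'I_d -> bool} :=
  [ffun i => z i (+) w i].

Lemma sg_xor d (z w : {ffun 'I_d -> bool}) i :
  sg (xorf z w) i = sg z i * sg w i.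
Proof. by rewrite /sg ffunE signr_addb. Qed.

Lemma xorfK d (z : {ffun 'I_d -> bool}) : involutive (xorf z).
Proof. by move=> w; apply/ffunP => i; rewrite !ffunE addbA addbb. Qed.

(* For [r = sqrt lam], conjugating [perturb r a W] by [sigma^(1/4)] gives a
   perturbation of [sigma]; this symmetric normalization gives the
   second moment [tr (Y_z Y_z')] without inverting [sigma]. *)
Definition perturb d (r a : 'I_d -> R) (W : 'M[R]_d) : 'M[R]_d :=
  dmx r + dmx a *m W.

Lemma perturbE d (r a : 'I_d -> R) (W : 'M[R]_d) i j :
  perturb r a W i j = r i *+ (i == j) + a i * W i j.
Proof. by rewrite mxE dmxE mul_dmx. Qed.

(** With [P] a projection and W^2 = P, the matrix Q = P + W satisfies Q^2 = 2 Q. As it commutes with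
    diag(a), the product diag(a) Q is a Gram matrix, and what remains is the nonnegative diagonal r
    - a P. *)
Lemma perturb_psd d (r a P : 'I_d -> R) (W : 'M[R]_d) :
  W^T = W -> W *m W = dmx P ->
  (forall i, 0 <= P i <= 1) -> (forall i, P i * P i = P i) ->
  (forall i j, P i * W i j = W i j) ->
  (forall i j, a i * W i j = W i j * a j) ->
  (forall i, 0 <= a i <= r i) ->
  psd (cplx (perturb r a W)).
Proof.
move=> hW WW P01 PP PW aW ar.
pose g i := Num.sqrt (a i / 2).
have gg i : g i * g i = a i / 2.
  by rewrite -expr2 sqr_sqrtr // divr_ge0 //; case/andP: (ar i).
pose Q := dmx P + W.
have aQ i j : a i * Q i j = Q i j * a j.
  rewrite /Q mxE dmxE mulrDr mulrDl aW; congr (_ + _).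
  by case: (eqVneq i j) => [->|_]; rewrite ?mulr1n ?mulr0n ?mulr0 ?mul0r // mulrC.
have QQ : Q *m Q = 2%:R *: Q.
  have e1 : dmx P *m W = W by apply/matrixP => i j; rewrite mul_dmx PW.
  have e2 : W *m dmx P = W.
    by rewrite -[RHS]hW -[in RHS]e1 trmx_mul hW dmx_tr.
  have e3 : dmx P *m dmx P = dmx P.
    by rewrite dmxM; congr (diag_mx _); apply/rowP => i; rewrite !mxE PP.
  rewrite /Q mulmxDl !mulmxDr e1 e2 e3 WW.
  by move: (dmx P) => Z; apply/matrixP => i j; rewrite !mxE; ring.
have QT : Q^T = Q by rewrite /Q linearD /= dmx_tr hW.
have -> : perturb r a W = dmx (fun i => r i - a i * P i) +
    (Q *m dmx g) *m (Q *m dmx g)^T.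
  have -> : (Q *m dmx g) *m (Q *m dmx g)^T = dmx a *m Q.
    apply/matrixP => i j; rewrite trmx_mul dmx_tr QT -mulmxA.
    have -> : Q *m (dmx g *m (dmx g *m Q)) = dmx (fun i => a i / 2) *m (Q *m Q).
      apply/matrixP => k l; rewrite mul_dmx !mxE mulr_sumr.
      apply: eq_bigr => m _; rewrite !mul_dmx !mulrA -(mulrA (Q k m)) gg.
      by rewrite mulrA -aQ; ring.
    by rewrite QQ !mul_dmx mxE; field.
  apply/matrixP => i j; rewrite perturbE [RHS]mxE dmxE mul_dmx [Q i j]mxE dmxE.
  by case: (eqVneq i j) => [->|_]; rewrite ?mulr1n ?mulr0n; ring.
rewrite cplxD; apply: psdD; last exact: psd_cplx_gram.
apply: psd_cplx_dmx => i; have := ar i; have := P01 i.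
by move=> /andP[p0 p1] /andP[a0 h]; nra.
Qed.

Lemma perturb_tr d (r a : 'I_d -> R) (W : 'M[R]_d) :
  W^T = W -> (forall i j, a i * W i j = W i j * a j) ->
  (perturb r a W)^T = perturb r a W.
Proof.
move=> hW aW; rewrite /perturb linearD /= trmx_mul !dmx_tr hW; congr (_ + _).
apply/matrixP => i j; rewrite mul_dmx aW mxE (bigD1 j) //= big1 => [|k /negbTE kj].
  by rewrite dmxE eqxx mulr1n addr0.
by rewrite dmxE kj mulr0n mulr0.
Qed.

(** The zero diagonals kill the terms linear in [W] or [W']. *)
Lemma mxtrace_perturb2 d (r a : 'I_d -> R) (W W' : 'M[R]_d) :
  (forall i, W i i = 0) -> (forall i, W' i i = 0) ->
  \tr (perturb r a W *m perturb r a W') =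
  \sum_i r i ^+ 2 + \sum_i \sum_j a i * W i j * (a j * W' j i).
Proof.
move=> h h'; rewrite mxtrace_mulE -big_split /=; apply: eq_bigr => i _.
rewrite (bigD1 i) //= [in RHS](bigD1 i) //= !perturbE h h' eqxx.
rewrite !(mulr0, mul0r, addr0, mulr1n, add0r) expr2; congr (_ + _).
apply: eq_bigr => j ji; rewrite !perturbE (eq_sym i j) (negbTE ji).
by rewrite !mulr0n !add0r.
Qed.

Lemma perturb_density d (U : 'M[C]_d) (lam a P : 'I_d -> R) (W : 'M[R]_d)
    (q := fun i => Num.sqrt (Num.sqrt (lam i)))
    (rho := (U *m cplx (dmx q)) *m
       cplx (perturb (fun i => Num.sqrt (lam i)) a W) *m
       adjmx (U *m cplx (dmx q))) :
  U \is unitarymx -> (forall i, 0 <= lam i) -> \sum_i lam i = 1 ->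
  W^T = W -> W *m W = dmx P -> (forall i, W i i = 0) ->
  (forall i, 0 <= P i <= 1) -> (forall i, P i * P i = P i) ->
  (forall i j, P i * W i j = W i j) ->
  (forall i j, a i * W i j = W i j * a j) ->
  (forall i, 0 <= a i <= Num.sqrt (lam i)) ->
  density rho.
Proof.
move=> hU lam0 lam1 hW WW W0 P01 PP PW aW ar; split.
  by apply: psd_conj; exact: perturb_psd WW P01 PP PW aW ar.
have -> : rho = U *m cplx (dmx q *m perturb (fun i => Num.sqrt (lam i)) a W *m dmx q)
    *m adjmx U.
  by rewrite /rho adjmxM adjmx_cplx dmx_tr !cplxM !mulmxA.
rewrite mxtrace_conj // mxtrace_mulC mulmxA dmxM -[RHS]/(1%:C) -[in RHS]lam1.
congr (_%:C); apply: eq_bigr => i _.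
rewrite mul_dmx perturbE W0 mulr0 addr0 eqxx mulr1n.
have s0 : 0 <= Num.sqrt (lam i) by exact: sqrtr_ge0.
by rewrite -(expr2 (q i)) sqr_sqrtr // -expr2 sqr_sqrtr.
Qed.

(** [W] is its own dual witness: the pairing is the sum of q_i a_i W_ij^2 q_j, where b_i = b_j <=
    q_i q_j whenever W_ij is nonzero, and row i of [W] has squared norm P_i. *)
Lemma perturb_far d (U : 'M[C]_d) (lam a b P : 'I_d -> R) (W : 'M[R]_d) (th eps : R)
    (q := fun i => Num.sqrt (Num.sqrt (lam i)))
    (A := U *m cplx (dmx q)) :
  U \is unitarymx ->
  W^T = W -> W *m W = dmx P -> (forall i, P i <= 1) ->
  (forall i j, b i * W i j = W i j * b j) ->
  (forall i, 0 <= b i) -> (forall i, b i ^+ 2 <= lam i) ->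
  0 <= th -> a = (fun i => th * b i) ->
  eps <= th * \sum_i b i ^+ 2 * P i ->
  eps <= schatten 1
    (A *m cplx (perturb (fun i => Num.sqrt (lam i)) a W) *m adjmx A -
     A *m cplx (dmx (fun i => Num.sqrt (lam i))) *m adjmx A).
Proof.
move=> hU hW WW P1 bW b0 bl th0 aE he.
have AE (Z : 'M[R]_d) : A *m cplx Z *m adjmx A =
    U *m cplx (dmx q *m Z *m dmx q) *m adjmx U.
  by rewrite /A adjmxM adjmx_cplx dmx_tr !cplxM !mulmxA.
have hsym i j : W j i = W i j by rewrite -[in LHS]hW mxE.
rewrite !AE conjB -mulmxBl -mulmxBr /perturb addrC addKr.
apply: le_trans he _.
have aW i j : a i * W i j = W i j * a j by rewrite aE -mulrA bW mulrCA.
have hX : (dmx q *m (dmx a *m W) *m dmx q)^T = dmx q *m (dmx a *m W) *m dmx q.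
  rewrite !trmx_mul !dmx_tr hW mulmxA; congr (_ *m _).
  have -> : W *m dmx a = dmx a *m W.
    apply/matrixP => i j; rewrite mul_dmx aW mxE (bigD1 j) //= big1.
      by rewrite dmxE eqxx mulr1n addr0.
    by move=> k /negbTE kj; rewrite dmxE kj mulr0n mulr0.
  by [].
apply: le_trans (schatten1_conj_ge hU hX hW WW P1).
rewrite mxtrace_mulE mulr_sumr; apply: ler_sum => i _.
have -> : b i ^+ 2 * P i = \sum_j b i ^+ 2 * W i j ^+ 2.
  rewrite -mulr_sumr; congr (_ * _).
  have := congr1 (fun X : 'M_d => X i i) WW.
  rewrite /= dmxE eqxx mulr1n => <-.
  by rewrite mxE; apply: eq_bigr => j _; rewrite hsym expr2.
rewrite mulr_sumr; apply: ler_sum => j _.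
have -> : (dmx q *m (dmx a *m W) *m dmx q) i j = q i * (a i * W i j) * q j.
  rewrite mxE (bigD1 j) //= big1 => [|k /negbTE kj].
    by rewrite !mul_dmx dmxE eqxx mulr1n addr0.
  by rewrite dmxE kj mulr0n mulr0.
rewrite (hsym i j) aE; case: (eqVneq (W i j) 0) => [->|Wij].
  by rewrite expr0n /= !mulr0.
have bij : b j = b i.
  by apply: (mulIf Wij); rewrite bW mulrC.
have lam0 k : 0 <= lam k by apply: le_trans (bl k); exact: sqr_ge0.
have bq k : b k <= q k ^+ 2.
  rewrite sqr_sqrtr ?sqrtr_ge0 //.
  by rewrite -(ger0_norm (b0 k)) -sqrtr_sqr ler_wsqrtr.
have qq : b i <= q i * q j.
  have q0 k : 0 <= q k by exact: sqrtr_ge0.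
  rewrite -ler_sqr ?nnegrE ?mulr_ge0 // exprMn expr2.
  by apply: ler_pM => //; rewrite -?bij.
have -> : q i * (th * b i * W i j) * q j * W i j =
    th * (b i * W i j ^+ 2) * (q i * q j) by ring.
have -> : th * (b i ^+ 2 * W i j ^+ 2) = th * (b i * W i j ^+ 2) * b i by ring.
apply: ler_wpM2l => //; apply: mulr_ge0 => //.
by apply: mulr_ge0 => //; exact: sqr_ge0.
Qed.

Definition flip d (z : {ffun 'I_d -> bool}) (W : 'M[R]_d) : 'M[R]_d :=
  \matrix_(i, j) (sg z i * W i j * sg z j).

Lemma flip_mul d (z : {ffun 'I_d -> bool}) (W : 'M[R]_d) (P : 'I_d -> R) :
  W *m W = dmx P -> flip z W *m flip z W = dmx P.
Proof.
move=> WW; apply/matrixP => i j; have := congr1 (fun X : 'M_d => X i j) WW.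
rewrite /= !dmxE !mxE => e.
have -> : \sum_k flip z W i k * flip z W k j =
    sg z i * (\sum_k W i k * W k j) * sg z j.
  rewrite mulr_sumr mulr_suml; apply: eq_bigr => k _; rewrite !mxE.
  have := sg2 z k; move: (sg z k) => u u2.
  transitivity (sg z i * (W i k * W k j) * sg z j * (u * u)); first by ring.
  by rewrite u2 mulr1.
rewrite e; case: (eqVneq i j) => [->|_]; rewrite ?mulr1n ?mulr0n ?mulr0 ?mul0r //.
by rewrite mulrC mulrA sg2 mul1r.
Qed.

(* The Ingster-Suslina second moment; the product of two independent sign
   vectors is again uniform, so only one average remains. *)
Lemma certifies_second_moment d (U : 'M[C]_d) (lam b P : 'I_d -> R)
    (W : 'M[R]_d) (th eps : R) n (M : 'M[C]_(d ^ n)) :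
  U \is unitarymx -> (forall i, 0 <= lam i) -> \sum_i lam i = 1 ->
  certifies (U *m cplx (dmx lam) *m adjmx U) eps n M ->
  W^T = W -> W *m W = dmx P -> (forall i, W i i = 0) ->
  (forall i, 0 <= P i <= 1) -> (forall i, P i * P i = P i) ->
  (forall i j, P i * W i j = W i j) ->
  (forall i j, b i * W i j = W i j * b j) ->
  (forall i, 0 <= b i) -> (forall i, b i ^+ 2 <= lam i) ->
  0 <= th <= 1 ->
  eps <= th * \sum_i b i ^+ 2 * P i ->
  10 / 9 * #|{ffun 'I_d -> bool}|%:R <=
    \sum_(w : {ffun 'I_d -> bool})
      (1 + th ^+ 2 * \sum_i \sum_j b i ^+ 2 * W i j ^+ 2 * (sg w i * sg w j)) ^+ n.
Proof.
move=> hU lam0 lam1 hc hW WW W0 P01 PP PW bW b0 bl /andP[th0 th1] he.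
pose q i := Num.sqrt (Num.sqrt (lam i)); pose r i := Num.sqrt (lam i).
pose a i := th * b i.
pose A := U *m cplx (dmx q).
have hsym i j : W j i = W i j by rewrite -[in LHS]hW mxE.
have q4 i : q i * (r i * q i) = lam i.
  rewrite mulrCA -(expr2 (q i)) sqr_sqrtr ?sqrtr_ge0 // -expr2 sqr_sqrtr //.
have ASA : U *m cplx (dmx lam) *m adjmx U = A *m cplx (dmx r) *m adjmx A.
  have -> : dmx lam = dmx q *m dmx r *m dmx q.
    rewrite !dmxM; congr (diag_mx _).
    by apply/rowP => i; rewrite !mxE -mulrA q4.
  by rewrite /A adjmxM adjmx_cplx dmx_tr !cplxM !mulmxA.
have fW z : (flip z W)^T = flip z W.
  by apply/matrixP => i j; rewrite !mxE hsym; ring.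
have fWW z := flip_mul z WW.
have fW0 z i : flip z W i i = 0 by rewrite mxE W0 mulr0 mul0r.
have fPW z i j : P i * flip z W i j = flip z W i j.
  by rewrite mxE -[in RHS]PW; ring.
have fbW z i j : b i * flip z W i j = flip z W i j * b j.
  rewrite mxE; transitivity (sg z i * (b i * W i j) * sg z j); first by ring.
  by rewrite bW; ring.
have faW z i j : a i * flip z W i j = flip z W i j * a j.
  by rewrite /a -mulrA fbW mulrCA.
have ar i : 0 <= a i <= r i.
  rewrite /a mulr_ge0 //=; apply: le_trans (_ : b i <= _).
    by rewrite ler_piMl.
  by rewrite -(ger0_norm (b0 i)) -sqrtr_sqr ler_wsqrtr.
have P1 i : P i <= 1 by case/andP: (P01 i).
pose Y z := cplx (perturb r a (flip z W)).
rewrite ASA in hc.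
have hS : Defs.hermitian (cplx (dmx r)).
  by rewrite /Defs.hermitian adjmx_cplx dmx_tr.
have hY z : Defs.hermitian (Y z).
  by rewrite /Defs.hermitian adjmx_cplx perturb_tr.
(* [A] times its adjoint is the square root of sigma, so this trace is that of sigma. *)
have trT : \tr (A *m adjmx A *m (A *m adjmx A)) = 1.
  rewrite /A cplx_gram conjM // mxtrace_conj // dmx_tr !dmxM mxtrace_dmx.
  rewrite -[RHS]/(1%:C) -[in RHS]lam1; congr (_%:C); apply: eq_bigr => i _.
  by rewrite -(expr2 (q i)) sqr_sqrtr ?sqrtr_ge0 // -expr2 sqr_sqrtr.
have dY z : density (A *m Y z *m adjmx A).
  exact: perturb_density (fWW z) _ _ _ _ _ _.
have hd z : eps <= schatten 1 (A *m Y z *m adjmx A - A *m cplx (dmx r) *m adjmx A).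
  exact: (perturb_far hU (fW z) (fWW z) P1 (fbW z) b0 bl th0 erefl he).
have := tpow_ensemble hc hS hY trT dY hd.
pose Q (w : {ffun 'I_d -> bool}) : R :=
  th ^+ 2 * \sum_i \sum_j b i ^+ 2 * W i j ^+ 2 * (sg w i * sg w j).
have lamr : \sum_i r i ^+ 2 = 1.
  by rewrite -[RHS]lam1; apply: eq_bigr => i _; rewrite sqr_sqrtr.
have rP0 : dmx r = perturb r a 0.
  by rewrite /perturb mulmx0 addr0.
have z0 i : (0 : 'M[R]_d) i i = 0 by rewrite mxE.
have tSS : \tr (cplx (dmx r) *m cplx (dmx r)) = 1.
  rewrite -cplxM mxtrace_cplx dmxM mxtrace_dmx -[RHS]/(1%:C) -[in RHS]lamr.
  by congr (_%:C); apply: eq_bigr => i _; rewrite expr2.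
have tSY z : \tr (cplx (dmx r) *m Y z) = 1.
  rewrite -cplxM mxtrace_cplx rP0 mxtrace_perturb2 //.
  rewrite lamr big1 ?addr0 // => i _; rewrite big1 // => j _.
  by rewrite mxE mulr0 mul0r.
have tYS z : \tr (Y z *m cplx (dmx r)) = 1 by rewrite mxtrace_mulC tSY.
have tYY z z' : \tr (Y z *m Y z') = (1 + Q (xorf z z'))%:C.
  rewrite -cplxM mxtrace_cplx mxtrace_perturb2 // lamr; congr ((_ + _)%:C).
  rewrite /Q mulr_sumr; apply: eq_bigr => i _.
  rewrite mulr_sumr; apply: eq_bigr => j _.
  rewrite !mxE !sg_xor (hsym i j) /a.
  (* Commutation with [b] forces b_i = b_j on the support of [W], which symmetrizes the weight to
     b_i^2. *)
  case: (eqVneq (W i j) 0) => [->|Wij]; first by rewrite expr0n /= !(mulr0, mul0r).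
  have -> : b j = b i by apply: (mulIf Wij); rewrite bW mulrC.
  by ring.
have -> : \sum_z \sum_z'
    complex.Re (\tr (cplx (dmx r) *m cplx (dmx r)) ^+ n
      - \tr (cplx (dmx r) *m Y z') ^+ n
      - \tr (Y z *m cplx (dmx r)) ^+ n + \tr (Y z *m Y z') ^+ n) =
  \sum_(z : {ffun 'I_d -> bool}) (\sum_w (1 + Q w) ^+ n - #|{ffun 'I_d -> bool}|%:R).
  apply: eq_bigr => z _.
  have -> : #|{ffun 'I_d -> bool}|%:R = \sum_(w : {ffun 'I_d -> bool}) (1 : R).
    by rewrite sumr_const.
  (* Substituting w = z xor z' makes the inner sum independent of z. The other three traces are 1
     and contribute -1 per pair. *)
  rewrite -sumrB [RHS](reindex_inj (inv_inj (xorfK z))) /=.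
  apply: eq_bigr => z' _; rewrite tSS tSY tYS tYY expr1n -rmorphXn.
  by rewrite subrr sub0r ReD ReN /= addrC.
have N0 : 0 < #|{ffun 'I_d -> bool}|%:R :> R.
  by rewrite ltr0n; apply/card_gt0P; exists [ffun=> true].
pose N : R := #|{ffun 'I_d -> bool}|%:R.
pose X := \sum_w (1 + Q w) ^+ n.
have -> : \sum_(z : {ffun 'I_d -> bool}) (X - N) = (X - N) * N.
  by rewrite sumr_const -mulr_natr.
rewrite -/N -/(\sum_w (1 + Q w) ^+ n) -/X => h.
have : N * (N / 9) <= N * (X - N) by rewrite mulrA -expr2 (mulrC N (X - N)).
by rewrite ler_pM2l //; lra.
Qed.

End Ensemble.

(** * Flat matrices and Rademacher chaos *)

Section FlatMatrices.
Variable R : realType.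

(** The Sylvester-Hadamard matrix of order 2^l: the sign is the parity of the inner product of the
    low [l] binary digits. *)
Fixpoint had (l x y : nat) : R :=
  if l is l'.+1 then had l' x./2 y./2 * (-1) ^+ (odd x && odd y) else 1.

Lemma had_sym l x y : had l x y = had l y x.
Proof. by elim: l x y => [//|l IH] x y /=; rewrite IH andbC. Qed.

Lemma had_sq l x y : had l x y ^+ 2 = 1.
Proof.
elim: l x y => [|l IH] x y /=; first by rewrite expr1n.
by rewrite exprMn IH mul1r sqrr_sign.
Qed.

Lemma sum_nat_double (F : nat -> R) m :
  \sum_(0 <= y < m.*2) F y = \sum_(0 <= y < m) (F y.*2 + F y.*2.+1).
Proof.
elim: m => [|m IH]; first by rewrite !big_nil.
by rewrite doubleS !big_nat_recr //= IH addrA.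
Qed.

(** Summing over the last digit of y first gives a factor 2 or 0 according to whether the last
    digits of x and x' agree; the other digits are handled by induction. *)
Lemma had_orth l x x' : (x < 2 ^ l)%N -> (x' < 2 ^ l)%N ->
  \sum_(0 <= y < 2 ^ l) had l x y * had l x' y = (2 ^ l)%:R *+ (x == x').
Proof.
elim: l x x' => [|l IH] x x'.
  rewrite expn0 !ltnS !leqn0 => /eqP -> /eqP ->.
  by rewrite big_nat1 mulr1.
move=> hx hx'; have {}IH := IH x./2 x'./2.
have e2 : (2 ^ l.+1 = (2 ^ l).*2)%N by rewrite expnS mul2n.
rewrite e2 in hx hx' *.
have {}IH := IH _ _.
have h2 : (x./2 < 2 ^ l)%N by lia.
have h2' : (x'./2 < 2 ^ l)%N by lia.
rewrite sum_nat_double.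
have -> : \sum_(0 <= y < 2 ^ l)
    (had l.+1 x y.*2 * had l.+1 x' y.*2
     + had l.+1 x y.*2.+1 * had l.+1 x' y.*2.+1) =
  (1 + (-1) ^+ odd x * (-1) ^+ odd x') *
    \sum_(0 <= y < 2 ^ l) had l x./2 y * had l x'./2 y.
  rewrite mulr_sumr; apply: eq_bigr => y _ /=.
  rewrite uphalf_double doubleK odd_double /= !andbF !andbT !expr0; ring.
rewrite IH //.
have -> : (x == x') = (odd x == odd x') && (x./2 == x'./2) by lia.
case: (odd x); case: (odd x'); rewrite /= ?expr1 ?expr0 ?mulrNN ?mulr1 ?mul1r ?addrN ?mul0r //.
- by rewrite -mul2n natrM -mulrnAr.
- by rewrite -mul2n natrM -mulrnAr.
Qed.

(** After sorting indices by parity this is the block matrix with zero diagonal blocks and the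
    Hadamard matrix in both off-diagonal blocks. *)
Definition biflat (l x y : nat) : R :=
  if odd x != odd y then had l x./2 y./2 else 0.

Lemma biflat_orth l x x' : (x < 2 ^ l.+1)%N -> (x' < 2 ^ l.+1)%N ->
  \sum_(0 <= y < 2 ^ l.+1) biflat l x y * biflat l y x' =
    (2 ^ l)%:R *+ (x == x').
Proof.
have e2 : (2 ^ l.+1 = (2 ^ l).*2)%N by rewrite expnS mul2n.
rewrite e2 => hx hx'.
have h2 : (x./2 < 2 ^ l)%N by lia.
have h2' : (x'./2 < 2 ^ l)%N by lia.
rewrite sum_nat_double.
have -> : (x == x') = (odd x == odd x') && (x./2 == x'./2) by lia.
have ho := had_orth h2 h2'.
under eq_bigr => y _ do
  rewrite /biflat /= uphalf_double doubleK odd_double /= !(had_sym l y).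
case: (odd x); case: (odd x') => /=.
- by under eq_bigr => y _ do rewrite mulr0 addr0; rewrite ho.
- by under eq_bigr => y _ do rewrite mulr0 mul0r addr0; rewrite big1.
- by under eq_bigr => y _ do rewrite mulr0 mul0r addr0; rewrite big1.
- by under eq_bigr => y _ do rewrite mulr0 add0r; rewrite ho.
Qed.

(** Which half of the bipartition of [G] contains [i], as a sign. *)
Definition side d (G : {set 'I_d}) (i : 'I_d) : R := (-1) ^+ odd (index i (enum G)).

Definition flatW d (l : nat) (G : {set 'I_d}) (i j : 'I_d) : R :=
  if (i \in G) && (j \in G) then
    (Num.sqrt (2 ^ l)%:R)^-1 * biflat l (index i (enum G)) (index j (enum G))
  else 0.

Lemma flatW_sym d l (G : {set 'I_d}) i j : flatW l G i j = flatW l G j i.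
Proof.
rewrite /flatW andbC; case: ifP => // _; congr (_ * _).
by rewrite /biflat eq_sym had_sym.
Qed.

(** In this form the squared entries have rank at most two, so their quadratic form is a difference
    of two squares of linear forms. *)
Lemma flatW_sq d l (G : {set 'I_d}) i j : i \in G -> j \in G ->
  flatW l G i j ^+ 2 = (1 - side G i * side G j) / (2 ^ l.+1)%:R.
Proof.
move=> iG jG; rewrite /flatW iG jG /= exprMn exprVn sqr_sqrtr //.
have p0 : (2 ^ l)%:R != 0 :> R by rewrite pnatr_eq0 expn_eq0.
rewrite expnS natrM /side /biflat.
case: (odd (index i _)); case: (odd (index j _));
  rewrite /= ?had_sq ?expr1 ?expr0 ?expr0n /=; field; exact: p0.
Qed.

Lemma sum_index d (G : {set 'I_d}) (F : nat -> R) :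
  \sum_(j in G) F (index j (enum G)) = \sum_(0 <= y < #|G|) F y.
Proof.
rewrite -big_enum cardE /=; case: (enum G) (enum_uniq G) => [|a s] us.
  by rewrite !big_nil.
rewrite (big_nth a); apply: eq_big_nat => y /andP[_ hy].
by rewrite index_uniq.
Qed.

Lemma flatW_orth d l (G : {set 'I_d}) i k : #|G| = (2 ^ l.+1)%N ->
  \sum_j flatW l G i j * flatW l G j k = ((i \in G) && (i == k))%:R.
Proof.
move=> cG; case: (boolP (i \in G)) => iG; last first.
  by rewrite big1 // => j _; rewrite /flatW (negbTE iG) mul0r.
case: (boolP (k \in G)) => kG; last first.
  rewrite big1 => [|j _]; first by case: eqP kG => // <-; rewrite iG.
  by rewrite /flatW (negbTE kG) andbF mulr0.
rewrite (bigID (fun j => j \in G)) /= [X in _ + X]big1 ?addr0; last first.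
  by move=> j /negbTE jG; rewrite /flatW jG andbF mul0r.
pose F y : R := ((2 ^ l)%:R)^-1 *
   (biflat l (index i (enum G)) y * biflat l y (index k (enum G))).
have -> : \sum_(j in G) flatW l G i j * flatW l G j k =
    \sum_(j in G) F (index j (enum G)).
  apply: eq_bigr => j jG; rewrite /flatW iG jG kG /= mulrACA /F -invfM.
  by rewrite -expr2 sqr_sqrtr.
have im a : a \in G -> (index a (enum G) < 2 ^ l.+1)%N.
  by move=> aG; rewrite -cG cardE index_mem mem_enum.
rewrite sum_index cG -mulr_sumr biflat_orth ?im //.
have -> : (index i (enum G) == index k (enum G)) = (i == k).
  apply/eqP/eqP => [e|->//].
  have ni a : a \in G -> nth i (enum G) (index a (enum G)) = a.
    by move=> aG; rewrite nth_index ?mem_enum.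
  by rewrite -(ni i iG) e ni.
case: eqP => _; rewrite ?mulr0 //= mulr1n mulVf //.
by rewrite pnatr_eq0 expn_eq0.
Qed.

End FlatMatrices.

(** * Exponential moments of quadratic forms in random signs *)

Section Chaos.
Variable R : realType.

(** The generous constant 2 allows an elementary split at 1/2: beyond it y <= 2 y^2, and below it
    the two exponentials are at most 1 / (1 - y) and 1 / (1 + y). *)
Lemma cosh_le (y : R) : expR y + expR (- y) <= 2 * expR (2 * y ^+ 2).
Proof.
wlog y0 : y / 0 <= y.
  move=> H; case: (lerP 0 y) => [/H //|yn].
  have := H (- y); rewrite opprK sqrrN addrC; apply.
  by rewrite oppr_ge0 ltW.
case: (lerP (1 / 2) y) => hy.
  have : expR y <= expR (2 * y ^+ 2) by rewrite ler_expR; nra.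
  have : expR (- y) <= expR (2 * y ^+ 2) by rewrite ler_expR; nra.
  lra.
have e1 := expR_ge1Dx (- y); have e2 := expR_ge1Dx y.
have e3 := expR_ge1Dx (2 * y ^+ 2).
rewrite !expRN in e1 *.
have E0 := expR_gt0 y.
set E := expR y in e1 e2 E0 *.
have hE : E <= (1 - y)^-1.
  rewrite -(invrK E) lef_pV2 ?posrE ?invr_gt0 //; lra.
have hE' : E^-1 <= (1 + y)^-1 by rewrite lef_pV2 ?posrE //; lra.
apply: le_trans (lerD hE hE') _.
have -> : (1 - y)^-1 + (1 + y)^-1 = 2 * (1 - y ^+ 2)^-1.
  have a : 1 - y != 0 by lra.
  have b : 1 + y != 0 by lra.
  have c : 1 - y ^+ 2 != 0 by nra.
  by field; rewrite a b c.
rewrite ler_pM2l //; apply: le_trans e3.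
have p : 0 < 1 - y ^+ 2 by nra.
have u1 : y ^+ 2 <= 1 / 4 by nra.
have u0 := sqr_ge0 y.
by rewrite -[leLHS]mul1r ler_pdivrMr //; move: (y ^+ 2) u0 u1 => u *; nra.
Qed.

Definition flipat d (i : 'I_d) (w : {ffun 'I_d -> bool}) : {ffun 'I_d -> bool} :=
  [ffun j => w j (+) (j == i)].

Lemma flipatK d (i : 'I_d) : involutive (flipat i).
Proof. by move=> w; apply/ffunP => j; rewrite !ffunE -addbA addbb addbF. Qed.

Lemma sg_flipat d (i j : 'I_d) w :
  sg R (flipat i w) j = if j == i then - sg R w j else sg R w j.
Proof.
rewrite /sg ffunE; case: eqP => _; last by rewrite addbF.
by rewrite signr_addb expr1 mulrN1.
Qed.

Definition gsum d J (g : 'I_d -> 'I_J) (l : seq 'I_d) (w : {ffun 'I_d -> bool})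
  (k : 'I_J) : R := \sum_(i <- l | g i == k) sg R w i.

(* Integrating out one sign replaces [B] by [B + 8 B^2], that is, it lowers
   [1/B] by at most 8; the hypothesis on [B] is stable under this. *)
Lemma chaos_bound d J (g : 'I_d -> 'I_J) (v : 'I_J -> R) (l : seq 'I_d)
    (B : 'I_J -> R) :
  uniq l -> (forall k, 0 < v k) -> (forall k, 0 <= B k) ->
  (forall k, B k * (8 * (count (fun i => g i == k) l)%:R + v k) <= 1) ->
  \sum_(w : {ffun 'I_d -> bool}) expR (\sum_k B k * gsum g l w k ^+ 2) <=
  #|{ffun 'I_d -> bool}|%:R * expR (\sum_(i <- l) (v (g i))^-1).
Proof.
elim: l B => [|i l IH] B.
  move=> _ _ _ _; rewrite big_nil expR0 mulr1.
  rewrite (eq_bigr (fun _ => 1)) ?sumr_const // => w _.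
  by rewrite big1 ?expR0 // => k _; rewrite /gsum big_nil expr0n mulr0.
move=> /= /andP[il ul] v0 B0 hB.
pose k0 := g i; pose b := B k0.
have b0 : 0 <= b by exact: B0.
pose B' k := if k == k0 then b + 8 * b ^+ 2 else B k.
pose N : R := (count (fun i => g i == k0) l)%:R.
have N0 : 0 <= N by [].
have hb : b * (8 * (1 + N) + v k0) <= 1.
  by have := hB k0; rewrite eqxx natrD.
have B'0 k : 0 <= B' k.
  rewrite /B'; case: ifP => _ //; have := sqr_ge0 b; lra.
have hB' k : B' k * (8 * (count (fun i => g i == k) l)%:R + v k) <= 1.
  rewrite /B'; case: eqP => [->|/eqP kk].
    have hu : b * (8 * N + v k0) <= 1 - 8 * b.
      by lra.
    have u0 : 0 <= 8 * N + v k0 by have := v0 k0; lra.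
    rewrite -/N; move: (8 * N + v k0) u0 hu => u u0 hu.
    (* Now b u <= 1 - 8 b, and (1 - 8 b)(1 + 8 b) <= 1. *)
    have -> : (b + 8 * b ^+ 2) * u = (b * u) * (1 + 8 * b) by ring.
    by nra.
  by have := hB k; rewrite eq_sym (negbTE kk).
have {}IH := IH B' ul v0 B'0 hB'.
rewrite big_cons expRD mulrCA.
(* Each integrated sign costs a factor exp(b), which is charged to the term 1 / v of its index. *)
have bv : b <= (v k0)^-1.
  rewrite -(ler_pM2r (v0 k0)) mulVf ?gt_eqF //.
  by have := v0 k0; nra.
apply: le_trans (_ : expR b * \sum_w expR (\sum_k B' k * gsum g l w k ^+ 2) <= _);
  last first.
  by apply: ler_pM; rewrite ?expR_ge0 ?ler_expR //; apply: sumr_ge0 => w _;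
    exact: expR_ge0.
(* Pairing [w] with its flip at [i] averages exp(b (S + s)^2) over s = 1 and s = -1, giving exp(b
   S^2 + b) cosh(2 b S). *)
pose F w := expR (\sum_k B k * gsum g (i :: l) w k ^+ 2).
have FF : \sum_w F w = \sum_w (F w + F (flipat i w)) / 2.
  have e : \sum_w F w = \sum_w F (flipat i w).
    by rewrite (reindex_inj (inv_inj (flipatK i))).
  by rewrite -mulr_suml big_split /= -e; field.
rewrite -[leLHS]/(\sum_w F w) FF mulr_sumr; apply: ler_sum => w _.
have gl k : gsum g l (flipat i w) k = gsum g l w k.
  rewrite /gsum big_seq_cond [RHS]big_seq_cond; apply: eq_bigr => j /andP[jl _].
  by rewrite sg_flipat; case: eqP jl => // ->; rewrite (negbTE il).
pose E := \sum_(k | k != k0) B k * gsum g l w k ^+ 2.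
pose S := gsum g l w k0.
have FE w' : (forall k, gsum g l w' k = gsum g l w k) ->
    F w' = expR (E + b * (S + sg R w' i) ^+ 2).
  move=> hw.
  have gk k : k != k0 -> gsum g (i :: l) w' k = gsum g l w k.
    by move=> kk; rewrite -hw /gsum big_cons -/k0 eq_sym (negbTE kk).
  have gk0 : gsum g (i :: l) w' k0 = S + sg R w' i.
    by rewrite /S -hw /gsum big_cons eqxx addrC.
  rewrite /F (_ : \sum_k _ = E + b * (S + sg R w' i) ^+ 2) //.
  rewrite (bigD1 k0) //= gk0 [LHS]addrC; apply: (congr2 +%R) => //.
  by apply: eq_bigr => k /gk ->.
rewrite (FE w) // (FE (flipat i w)) // sg_flipat eqxx.
have s2 := sg2 R w i; move: (sg R w i) s2 => s s2.
have -> : E + b * (S + s) ^+ 2 = (E + b * S ^+ 2 + b) + 2 * b * S * s.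
  by transitivity (E + b * (S ^+ 2 + s * s + 2 * S * s)); [|rewrite s2]; ring.
have -> : E + b * (S - s) ^+ 2 = (E + b * S ^+ 2 + b) + - (2 * b * S * s).
  by transitivity (E + b * (S ^+ 2 + s * s - 2 * S * s)); [|rewrite s2]; ring.
have -> : \sum_k B' k * gsum g l w k ^+ 2 = E + (b + 8 * b ^+ 2) * S ^+ 2.
  rewrite (bigD1 k0) //= {1}/B' eqxx addrC; congr (_ + _).
  by apply: eq_bigr => k /negbTE kk; rewrite /B' kk.
rewrite !(expRD (E + b * S ^+ 2 + b)) -mulrDr -expRD.
have -> : b + (E + (b + 8 * b ^+ 2) * S ^+ 2) =
    (E + b * S ^+ 2 + b) + 8 * b ^+ 2 * S ^+ 2 by ring.
rewrite (expRD (E + b * S ^+ 2 + b) (8 * b ^+ 2 * S ^+ 2)) -mulrA.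
rewrite ler_pM2l ?expR_gt0 // ler_pdivrMr // [leRHS]mulrC.
apply: le_trans (cosh_le _) _; rewrite ler_pM2l // ler_expR.
have -> : (2 * b * S * s) ^+ 2 = 4 * b ^+ 2 * S ^+ 2 * (s * s) by ring.
by rewrite s2 mulr1; lra.
Qed.

End Chaos.

(** * Lower bound from a union of dyadic blocks *)

Section BlockBound.
Variable R : realType.
Local Notation C := R[i].

Lemma geometric_tail_le J k0 :
  \sum_(k < J | (k0 <= k)%N) (2 ^- k : R) <= 2 * 2 ^- k0.
Proof.
have p m : 0 < 2 ^- m :> R by rewrite invr_gt0 exprn_gt0.
case: (leqP J k0) => hJ.
  rewrite big1 => [|k hk]; first by rewrite mulr_ge0 // ltW.
  by have := ltn_ord k; lia.
suff : \sum_(k < J | (k0 <= k)%N) (2 ^- k : R) <= 2 * 2 ^- k0 - 2 * 2 ^- J.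
  by have := p J; lra.
elim: J hJ => [//|J IH] hJ; rewrite big_mkcond big_ord_recr /= -big_mkcond /=.
have e : 2 ^- J = 2 * 2 ^- J.+1 :> R by rewrite exprS; field; rewrite gt_eqF ?exprn_gt0.
case: (ltngtP k0 J) hJ => [h|h|->] hJ; last 2 first.
- by lia.
- rewrite big1 => [|k hk]; last by have := ltn_ord k; lia.
  by rewrite e; lra.
by have := IH h; lra.
Qed.

(* Hadamard-type perturbations of size proportional to [2^-(k+1)] inside the
   blocks [G k], [k] in [K]. *)
Lemma block_bound d J (U : 'M[C]_d) (lam : 'I_d -> R) (eps : R) n
    (M : 'M[C]_(d ^ n)) (g : 'I_d -> 'I_J) (K : {set 'I_J})
    (G : 'I_J -> {set 'I_d}) (l : 'I_J -> nat) (k0 : nat) :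
  U \is unitarymx -> (forall i, 0 <= lam i) -> \sum_i lam i = 1 -> 0 < eps ->
  certifies (U *m cplx (dmx lam) *m adjmx U) eps n M ->
  (forall k, k \in K -> #|G k| = (2 ^ (l k).+1)%N) ->
  (forall k i, k \in K -> i \in G k -> g i = k) ->
  (forall k i, k \in K -> i \in G k -> 2 ^- k.+1 <= lam i) ->
  (forall k, k \in K -> (k0 <= k)%N) ->
  let m := \sum_(k in K) 2 ^- k.+1 * #|G k|%:R in
  eps <= m -> 2 ^+ k0 * m ^+ 2 <= 24 * n%:R * eps ^+ 2.
Proof.
move=> hU lam0 lam1 e0 hc cG gG lamG hk0 m em.
have m0 : 0 < m by lra.
rewrite leNgt; apply/negP => lt.
(* The smallest amplitude that still makes the perturbed states eps-far. The negated conclusion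
   becomes [hth]. *)
pose th := eps / m.
have th0 : 0 <= th by rewrite divr_ge0 // ltW.
have th1 : th <= 1 by rewrite ler_pdivrMr // mul1r.
have hth : 24 * n%:R * th ^+ 2 <= 2 ^+ k0.
  rewrite exprMn exprVn mulrA ler_pdivrMr ?exprn_gt0 //; exact: ltW.
pose inG i := (g i \in K) && (i \in G (g i)).
pose W : 'M[R]_d := \matrix_(i, j)
  (if (g i == g j) && (g i \in K) then flatW R (l (g i)) (G (g i)) i j else 0).
pose P i : R := (inG i)%:R.
(* The bucket's lower endpoint replaces lam_i here, which makes [b] constant on each block and hence
   commute with [W]. *)
pose b i : R := if inG i then Num.sqrt (2 ^- (g i).+1) else 0.
have p2 k : 0 < 2 ^- k :> R by rewrite invr_gt0 exprn_gt0.
have WG i j : W i j != 0 -> [/\ inG i, inG j & g i = g j].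
  rewrite mxE /flatW; case: ifP => [/andP[/eqP gij gK]|_]; last by rewrite eqxx.
  case: ifP => [/andP[iG jG] _|_]; last by rewrite eqxx.
  by rewrite /inG -gij gK iG jG.
have hW : W^T = W.
  apply/matrixP => i j; rewrite !mxE eq_sym.
  by case: (eqVneq (g i) (g j)) => [<-|//]; rewrite flatW_sym.
have WW : W *m W = dmx P.
  apply/matrixP => i k; rewrite dmxE mxE /P /inG.
  case: (boolP (g i \in K)) => gK; last first.
    by rewrite /= mul0rn big1 // => j _; rewrite mxE (negbTE gK) andbF mul0r.
  have -> : \sum_j W i j * W j k = (if g i == g k then
     \sum_j flatW R (l (g i)) (G (g i)) i j * flatW R (l (g i)) (G (g i)) j k
     else 0).
    case: ifP => [/eqP gik|gik].
      apply: eq_bigr => j _; rewrite !mxE -gik gK.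
      case: (eqVneq (g i) (g j)) => [<-|gij]; first by rewrite ?eqxx gK.
      rewrite /= mul0r /flatW; case: ifP => [/andP[_ jG]|_]; last by rewrite mul0r.
      by rewrite (gG _ j gK jG) eqxx in gij.
    rewrite big1 // => j _; rewrite !mxE.
    case: (eqVneq (g i) (g j)) => [<-|gij]; last by rewrite mul0r.
    by rewrite gik mulr0.
  rewrite (flatW_orth R _ _ (cG _ gK)) /=.
  case: (eqVneq i k) => [<-|ik]; rewrite ?eqxx ?andbT ?andbF ?mulr1n ?mulr0n //.
  by case: ifP.
have W0 i : W i i = 0.
  rewrite mxE eqxx; case: ifP => // _; rewrite /flatW /biflat eqxx mulr0.
  by case: ifP.
have P01 i : 0 <= P i <= 1 by rewrite /P; case: (inG i); rewrite /= ?lexx ?ler01.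
have PP i : P i * P i = P i by rewrite /P; case: (inG i); rewrite ?mulr1 ?mulr0.
have PW i j : P i * W i j = W i j.
  case: (eqVneq (W i j) 0) => [->|/WG[hi _ _]]; first by rewrite mulr0.
  by rewrite /P hi mul1r.
have bW i j : b i * W i j = W i j * b j.
  case: (eqVneq (W i j) 0) => [->|/WG[hi hj hij]]; first by rewrite mulr0 mul0r.
  by rewrite /b hi hj hij mulrC.
have b0 i : 0 <= b i by rewrite /b; case: ifP => // _; exact: sqrtr_ge0.
have b2 i : b i ^+ 2 = 2 ^- (g i).+1 * P i.
  rewrite /b /P; case: ifP => _; last by rewrite expr0n mulr0.
  by rewrite mulr1 sqr_sqrtr // ltW.
have bl i : b i ^+ 2 <= lam i.
  rewrite b2 /P; case: (boolP (inG i)) => [/andP[gK iG]|_].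
    by rewrite mulr1; exact: lamG iG.
  by rewrite mulr0.
have sumP (f : 'I_J -> R) :
    \sum_i f (g i) * P i = \sum_(k in K) f k * #|G k|%:R.
  rewrite (partition_big g (fun k => true)) //= [RHS]big_mkcond /=.
  apply: eq_bigr => k _; case: ifP => kK.
    have -> : f k * #|G k|%:R = \sum_(i in G k) f k.
      by rewrite sumr_const mulr_natr.
    rewrite big_mkcond [RHS]big_mkcond; apply: eq_bigr => i _.
    case: (eqVneq (g i) k) => [gik|gik].
      rewrite /P /inG gik kK /=.
      by case: ifP => _; rewrite ?mulr1 ?mulr0.
    by case: ifP => // iG; rewrite (gG _ _ kK iG) eqxx in gik.
  by rewrite big1 // => i /eqP gik; rewrite /P /inG gik kK mulr0.
have mE : \sum_i b i ^+ 2 * P i = m.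
  rewrite /m -(sumP (fun k => 2 ^- k.+1)); apply: eq_bigr => i _.
  by rewrite b2 -mulrA PP.
have he : eps <= th * \sum_i b i ^+ 2 * P i.
  by rewrite mE /th mulfVK ?gt_eqF.
have th01 : 0 <= th <= 1 by rewrite th0.
have := certifies_second_moment hU lam0 lam1 hc hW WW W0 P01 PP PW bW b0 bl th01 he.
pose s := [seq i <- enum 'I_d | inG i].
have us : uniq s by rewrite filter_uniq // enum_uniq.
pose Q (w : {ffun 'I_d -> bool}) : R := th ^+ 2 *
  \sum_i \sum_j b i ^+ 2 * W i j ^+ 2 * (sg R w i * sg R w j).
have Wsq i : \sum_j W i j ^+ 2 = P i.
  have := congr1 (fun X : 'M_d => X i i) WW; rewrite /= dmxE eqxx mulr1n => <-.
  rewrite [RHS]mxE; apply: eq_bigr => j _.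
  have -> : W j i = W i j by rewrite -[in LHS]hW mxE.
  by rewrite expr2.
have sgsg (w : {ffun 'I_d -> bool}) i j : -1 <= sg R w i * sg R w j.
  by rewrite /sg -signr_addb; case: (_ (+) _); rewrite ?expr1 ?expr0; lra.
(* Ensures 1 + Q >= 0, so that 1 + Q <= exp(Q) may be raised to the n-th power. *)
have Qm1 w : -1 <= Q w.
  have : - \sum_i lam i <=
      \sum_i \sum_j b i ^+ 2 * W i j ^+ 2 * (sg R w i * sg R w j).
    rewrite -sumrN; apply: ler_sum => i _.
    apply: le_trans (_ : \sum_j b i ^+ 2 * W i j ^+ 2 * (-1) <= _); last first.
      apply: ler_sum => j _; apply: ler_wpM2l => //.
      by rewrite mulr_ge0 ?sqr_ge0.
    rewrite -mulr_suml -mulr_sumr Wsq mulrN1 lerN2.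
    apply: le_trans (bl i); rewrite ler_piMr ?sqr_ge0 //.
    by case/andP: (P01 i).
  rewrite lam1 /Q; move: (\sum_i \sum_j _) => X hX.
  have : th ^+ 2 <= 1 by rewrite exprn_ile1.
  by have := sqr_ge0 th; nra.
have gsE k (w : {ffun 'I_d -> bool}) : k \in K ->
    gsum R g s w k = \sum_(i in G k) sg R w i.
  move=> kK; rewrite /gsum big_filter_cond big_enum_cond /=.
  apply: eq_bigl => i; rewrite /inG; apply/andP/idP => [[/andP[_ iG] /eqP <-]//|iG].
  by rewrite (gG _ _ kK iG) kK iG eqxx.
pose beta k : R := if k \in K then th ^+ 2 * 2 ^- k.+1 / #|G k|%:R else 0.
have Qle w : Q w <= \sum_k beta k * gsum R g s w k ^+ 2.
  have -> : Q w = \sum_(k in K) th ^+ 2 * 2 ^- k.+1 *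
      \sum_(i in G k) \sum_(j in G k)
        flatW R (l k) (G k) i j ^+ 2 * (sg R w i * sg R w j).
    rewrite /Q mulr_sumr (partition_big g (fun k => true)) //=.
    rewrite [RHS]big_mkcond /=; apply: eq_bigr => k _; case: ifP => kK; last first.
      rewrite big1 // => i /eqP gik; rewrite big1 ?mulr0 // => j _.
      by rewrite b2 /P /inG gik kK !(mulr0, mul0r).
    rewrite mulr_sumr big_mkcond [RHS]big_mkcond; apply: eq_bigr => i _.
    case: (boolP (i \in G k)) => iG; last first.
      case: eqP => // gik; rewrite big1 ?mulr0 // => j _.
      by rewrite b2 /P /inG gik (negbTE iG) andbF !(mulr0, mul0r).
    have gik := gG _ _ kK iG.
    rewrite gik eqxx -mulrA; congr (_ * _).
    rewrite mulr_sumr [RHS]big_mkcond; apply: eq_bigr => j _.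
    rewrite b2 /P /inG gik kK iG mulr1 !mxE gik kK andbT.
    case: (boolP (j \in G k)) => jG.
      by rewrite (gG _ _ kK jG) eqxx [RHS]mulrA.
    case: ifP => _; last by rewrite expr0n !(mulr0, mul0r).
    by rewrite /flatW (negbTE jG) andbF expr0n !(mulr0, mul0r).
  rewrite big_mkcond; apply: ler_sum => k _; rewrite /beta.
  case: ifP => kK; last by rewrite mul0r.
  rewrite gsE // -[X in _ <= X]mulrA; apply: ler_wpM2l.
    by rewrite mulr_ge0 ?sqr_ge0 // ltW.
  have -> : \sum_(i in G k) \sum_(j in G k)
      flatW R (l k) (G k) i j ^+ 2 * (sg R w i * sg R w j) =
    (#|G k|%:R)^-1 * ((\sum_(i in G k) sg R w i) ^+ 2 -
       (\sum_(i in G k) side R (G k) i * sg R w i) ^+ 2).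
    rewrite !expr2 !mulr_suml -sumrB mulr_sumr; apply: eq_bigr => i iG.
    rewrite !mulr_sumr -sumrB mulr_sumr; apply: eq_bigr => j jG.
    by rewrite flatW_sq // (cG _ kK); ring.
  apply: ler_wpM2l; first by rewrite invr_ge0.
  by rewrite gerBl sqr_ge0.
pose B k := n%:R * beta k.
(* The factor 2^(k - k0) makes the sum of 1 / v geometric, of total at most 1/20. The requirement on
   [B] then reads n th^2 (4 / 2^k + 20 / 2^k0) <= 1, which is where 24 comes from. *)
pose v (k : 'I_J) : R := if k \in K then 40 * #|G k|%:R * (2 ^+ k / 2 ^+ k0) else 1.
have G0 k : k \in K -> 0 < #|G k|%:R :> R.
  by move=> kK; rewrite (cG _ kK) ltr0n expn_gt0.
have v0 k : 0 < v k.
  rewrite /v; case: ifP => // kK; rewrite mulr_gt0 ?mulr_gt0 ?G0 //.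
  by rewrite ?invr_gt0 exprn_gt0.
have B0 k : 0 <= B k.
  rewrite /B /beta; case: ifP => _; last by rewrite mulr0.
  by rewrite mulr_ge0 // divr_ge0 // mulr_ge0 ?sqr_ge0 // ltW.
have cs k : k \in K -> count (fun i => g i == k) s = #|G k|.
  move=> kK; rewrite count_filter -sum1_count big_enum_cond /= sum1_card.
  apply: eq_card => i; rewrite [LHS]unfold_in /inG.
  apply/andP/idP => [[/eqP <- /andP[]]//|iG].
  by rewrite (gG _ _ kK iG) kK iG eqxx.
have hB k : B k * (8 * (count (fun i => g i == k) s)%:R + v k) <= 1.
  rewrite /B /beta /v; case: ifP => kK; last by rewrite mulr0 mul0r.
  rewrite (cs _ kK); have g0 := G0 _ kK.
  have -> : n%:R * (th ^+ 2 * 2 ^- k.+1 / #|G k|%:R) *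
      (8 * #|G k|%:R + 40 * #|G k|%:R * (2 ^+ k / 2 ^+ k0)) =
      n%:R * th ^+ 2 * (2 ^- k.+1 * (8 + 40 * (2 ^+ k / 2 ^+ k0))).
    have g1 : #|G k|%:R != 0 :> R by rewrite gt_eqF.
    move: (2 ^- k.+1) (2 ^+ k / 2 ^+ k0) (#|G k|%:R : R) g1 => x y z z0.
    by field.
  have kk := hk0 _ kK.
  have q0 : 0 < 2 ^+ k0 :> R by rewrite exprn_gt0.
  have qk : 0 < 2 ^+ k :> R by rewrite exprn_gt0.
  have q1 : 2 ^+ k0 <= 2 ^+ k :> R by rewrite ler_weXn2l // ler1n.
  have hh : 2 ^- k.+1 * (8 + 40 * (2 ^+ k / 2 ^+ k0)) <= 24 / 2 ^+ k0 :> R.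
    rewrite exprS invfM.
    have -> : 2^-1 / 2 ^+ k * (8 + 40 * (2 ^+ k / 2 ^+ k0)) =
        4 / 2 ^+ k + 20 / 2 ^+ k0 :> R.
      by field; rewrite !gt_eqF.
    have : (2 ^+ k)^-1 <= (2 ^+ k0)^-1 :> R by rewrite lef_pV2 ?posrE.
    by lra.
  have nt : 0 <= n%:R * th ^+ 2 by rewrite mulr_ge0 // sqr_ge0.
  apply: le_trans (ler_wpM2l nt hh) _.
  by rewrite mulrA ler_pdivrMr // mul1r; lra.
have chaos := chaos_bound us v0 B0 hB.
have hv : \sum_(i <- s) (v (g i))^-1 <= 1 / 20.
  have -> : \sum_(i <- s) (v (g i))^-1 = \sum_i (v (g i))^-1 * P i.
    rewrite big_filter big_enum_cond big_mkcond; apply: eq_bigr => i _.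
    by rewrite /P; case: (inG i); rewrite ?mulr1 ?mulr0.
  rewrite (sumP (fun k => (v k)^-1)).
  have -> : \sum_(k in K) (v k)^-1 * #|G k|%:R =
      \sum_(k in K) (2 ^+ k0 / 40) * 2 ^- k.
    apply: eq_bigr => k kK; rewrite /v kK.
    have q0 : 2 ^+ k0 != 0 :> R by rewrite gt_eqF // exprn_gt0.
    have qk : 2 ^+ k != 0 :> R by rewrite gt_eqF // exprn_gt0.
    have g1 : #|G k|%:R != 0 :> R by rewrite gt_eqF // G0.
    by field; rewrite q0 qk g1.
  rewrite -mulr_sumr.
  have : \sum_(k in K) 2 ^- k <= 2 * 2 ^- k0 :> R.
    apply: le_trans (geometric_tail_le J k0).
    rewrite big_mkcond [leRHS]big_mkcond; apply: ler_sum => k _.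
    case: ifP => kK; first by rewrite hk0.
    by case: ifP => _ //; rewrite ltW.
  have q0 : 0 < 2 ^+ k0 :> R by rewrite exprn_gt0.
  have q1 : 2 ^+ k0 * 2 ^- k0 = 1 :> R by rewrite mulfV // gt_eqF.
  move: (\sum_(k in K) _) => X hX.
  have : 2 ^+ k0 * X <= 2 ^+ k0 * (2 * 2 ^- k0) by rewrite ler_wpM2l // ltW.
  by rewrite mulrCA q1 mulr1; lra.
have main : \sum_w (1 + Q w) ^+ n <=
    \sum_(w : {ffun 'I_d -> bool}) expR (\sum_k B k * gsum R g s w k ^+ 2).
  apply: ler_sum => w _.
  have -> : \sum_k B k * gsum R g s w k ^+ 2 =
      n%:R * \sum_k beta k * gsum R g s w k ^+ 2.
    by rewrite mulr_sumr; apply: eq_bigr => k _; rewrite mulrA.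
  rewrite expRM_natl; apply: lerXn2r; rewrite ?nnegrE ?expR_ge0 //.
    by have := Qm1 w; lra.
  apply: le_trans (expR_ge1Dx _) _.
  by rewrite ler_expR.
have N0 : 0 < #|{ffun 'I_d -> bool}|%:R :> R.
  by rewrite ltr0n; apply/card_gt0P; exists [ffun=> true].
(* From exp(-1/20) >= 19/20, exp(1/20) <= 20/19 < 10/9, contradicting the second moment bound. *)
have e20 : expR (\sum_(i <- s) (v (g i))^-1) < 10 / 9 :> R.
  have h1 : expR (\sum_(i <- s) (v (g i))^-1) <= expR (1 / 20) :> R.
    by rewrite ler_expR.
  have h2 := expR_ge1Dx (- (1 / 20) : R); rewrite expRN in h2.
  have E0 := expR_gt0 (1 / 20 : R).
  have h3 : expR (1 / 20) * (expR (1 / 20))^-1 = 1 :> R by rewrite mulfV ?gt_eqF.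
  move: (expR (1 / 20)) (expR _) h1 h2 E0 h3 => E X h1 h2 E0 h3.
  by nra.
move=> low; have := le_trans low (le_trans main chaos).
rewrite mulrC ler_pM2l //; lra.
Qed.

End BlockBound.

(** * Buckets *)

Section Buckets.
Variable R : realType.
Local Notation C := R[i].

Lemma inv2X_gt0 k : 0 < 2 ^- k :> R.
Proof. by rewrite invr_gt0 exprn_gt0. Qed.

Lemma inv2X_le j k : (j <= k)%N -> 2 ^- k <= 2 ^- j :> R.
Proof. by move=> jk; rewrite lef_pV2 ?posrE ?exprn_gt0 // ler_weXn2l // ler1n. Qed.

Lemma inv2XS k : 2 ^- k.+1 = 2 ^- k / 2 :> R.
Proof. by rewrite exprS; field; rewrite gt_eqF ?exprn_gt0. Qed.

Lemma in_bucket_exists (a : R) : 0 < a <= 1 -> exists j, in_bucket j a.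
Proof.
move=> /andP[a0 a1].
have ex : exists j, 2 ^- j.+1 < a.
  exists (Num.bound a^-1); rewrite -[ltRHS]invrK ltf_pV2 ?posrE ?invr_gt0 ?exprn_gt0 //.
  apply: lt_trans (archi_boundP _) _; first by rewrite invr_ge0 ltW.
  by rewrite -natrX ltr_nat (leq_trans (ltn_expl _ (ltnSn 1))) // leq_exp2l.
exists (ex_minn ex); case: ex_minnP => j hj hmin; split => //.
case: j hj hmin => [|j] hj hmin; first by rewrite expr0 invr1.
by rewrite leNgt; apply/negP => h; have := hmin _ h; rewrite ltnn.
Qed.

Lemma in_bucket_uniq (a : R) j k : in_bucket j a -> in_bucket k a -> j = k.
Proof.
have aux m p : in_bucket m a -> in_bucket p a -> (p <= m)%N.
  move=> [h1 h2] [h3 h4]; rewrite leqNgt; apply/negP => mp.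
  have := inv2X_le mp; lra.
by move=> h h'; apply/eqP; rewrite eqn_leq !aux.
Qed.

Lemma bucket_index_exists d (lam : 'I_d -> R) :
  (forall i, 0 <= lam i) -> (forall i, lam i <= 1) ->
  exists b : 'I_d -> nat, forall i, i \in supp lam -> in_bucket (b i) (lam i).
Proof.
move=> lam0 lam1.
have ex i : exists j, i \in supp lam -> in_bucket j (lam i).
  case: (boolP (i \in supp lam)) => hi; last by exists 0%N.
  have [j hj] : exists j, in_bucket j (lam i).
    by apply: in_bucket_exists; move: hi; rewrite inE lt_def lam0 lam1 => ->.
  by exists j.
by have [b hb] := boolp.choice ex; exists b.
Qed.

Lemma mul_inv_sq (X x D : R) : X * x = 1 -> X * (x * D) ^+ 2 = D ^+ 2 * x.
Proof.
move=> Xx; transitivity ((X * x) * (D ^+ 2 * x)); first by ring.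
by rewrite Xx mul1r.
Qed.

Section FixedSpectrum.
Variables (d : nat) (lam : 'I_d -> R) (b : 'I_d -> nat).
Hypothesis lam0 : forall i, 0 <= lam i.
Hypothesis lam1 : \sum_i lam i = 1.
Hypothesis hb : forall i, i \in supp lam -> in_bucket (b i) (lam i).

Definition bucket j : {set 'I_d} := [set i in supp lam | b i == j].

Lemma bucket_sizeE i : i \in supp lam -> bucket_size lam i = #|bucket (b i)|.
Proof.
move=> hi; apply: eq_card => k; rewrite !inE.
case: (boolP (lam k != 0)) => //= hk; have hk' : k \in supp lam by rewrite inE.
apply/asboolP/eqP => [[j [h1 h2]]|e].
  by rewrite (in_bucket_uniq (hb hk') h2) (in_bucket_uniq (hb hi) h1).
by exists (b i); split; [exact: hb | rewrite -e; exact: hb].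
Qed.

Lemma mem_bucket i : i \in supp lam -> i \in bucket (b i).
Proof. by move=> hi; rewrite inE hi eqxx. Qed.

Lemma bucketP i k : i \in bucket k -> [/\ i \in supp lam, b i = k,
  2 ^- k.+1 < lam i & lam i <= 2 ^- k].
Proof. by rewrite inE => /andP[hi /eqP <-]; have [] := hb hi. Qed.

Lemma card_bucket_gt0 i : i \in supp lam -> (0 < #|bucket (b i)|)%N.
Proof. by move=> hi; apply/card_gt0P; exists i; exact: mem_bucket. Qed.

Lemma lhatE i : i \in supp lam -> lhat lam i = lam i / #|bucket (b i)|%:R.
Proof. by move=> hi; rewrite /lhat bucket_sizeE. Qed.

(** Bucket numbers are moved into a finite type large enough for [inord] to preserve all of them. *)
Let J := (\max_i b i).+1.
Let g (i : 'I_d) : 'I_J := inord (b i).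

Let gE i : g i = b i :> nat.
Proof. by rewrite inordK // ltnS; exact: leq_bigmax. Qed.

(** Each bucket is cut down to the largest power of two it contains. This loses a factor 2 in size,
    and the lower endpoint 2^-(k+1) loses another, so p <= 4 m and 384 = 16 * 24. *)
Lemma bucket_union_bound (U : 'M[C]_d) (eps : R) n (M : 'M[C]_(d ^ n))
    (K : {set 'I_J}) (k0 : nat) :
  U \is unitarymx -> 0 < eps ->
  certifies (U *m cplx (dmx lam) *m adjmx U) eps n M ->
  (forall k, k \in K -> (2 <= #|bucket k|)%N) ->
  (forall k, k \in K -> (k0 <= k)%N) ->
  let p := \sum_(k in K) 2 ^- k * #|bucket k|%:R in
  4 * eps <= p -> 2 ^+ k0 * p ^+ 2 <= 384 * n%:R * eps ^+ 2.
Proof.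
move=> hU e0 hc K2 hk0 p hp.
(* Bucket size at least 2 gives t >= 1, so the block has size 2^(l+1) with l = t - 1. *)
pose t (k : 'I_J) := trunc_log 2 #|bucket k|.
pose G (k : 'I_J) : {set 'I_d} := [set x in take (2 ^ t k) (enum (bucket k))].
have tb k : k \in K -> [/\ (0 < t k)%N, (2 ^ t k <= #|bucket k|)%N &
    (#|bucket k| < 2 ^ (t k).+1)%N].
  move=> kK; have h2 := K2 _ kK; split.
  - by rewrite trunc_log_gt0.
  - by apply: trunc_logP => //; lia.
  - by apply: trunc_log_ltn.
have cG k : k \in K -> #|G k| = (2 ^ (t k).-1.+1)%N.
  move=> kK; have [t0 h1 h2] := tb _ kK; rewrite prednK //.
  rewrite /G cardsE.
  have /card_uniqP -> : uniq (take (2 ^ t k) (enum (bucket k))).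
    by rewrite take_uniq // enum_uniq.
  by rewrite size_takel // -cardE.
have Gb k i : i \in G k -> i \in bucket k.
  by rewrite inE => /mem_take; rewrite mem_enum.
have gG k i : k \in K -> i \in G k -> g i = k.
  move=> _ /Gb /bucketP[_ e _ _]; apply/val_inj; rewrite /= gE //.
have lG k i : k \in K -> i \in G k -> 2 ^- k.+1 <= lam i.
  by move=> _ /Gb /bucketP[_ _ h _]; exact: ltW.
pose m := \sum_(k in K) 2 ^- k.+1 * #|G k|%:R : R.
have pm : p <= 4 * m.
  rewrite /p /m mulr_sumr; apply: ler_sum => k kK.
  have [t0 h1 h2] := tb _ kK.
  rewrite inv2XS (cG _ kK) prednK //.
  have : #|bucket k|%:R <= 2 * (2 ^ t k)%:R :> R.
    by rewrite -natrM ler_nat -expnS ltnW.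
  have := inv2X_gt0 k; move: (2 ^- k) (#|_|%:R) ((2 ^ t k)%:R) => x y z x0 h.
  by nra.
have em : eps <= m by lra.
have := block_bound hU lam0 lam1 e0 hc cG gG lG hk0 em.
have q0 : 0 < 2 ^+ k0 :> R by rewrite exprn_gt0.
have : p ^+ 2 <= 16 * m ^+ 2 by nra.
rewrite -/m; move: (p ^+ 2) (m ^+ 2) (2 ^+ k0) q0 => x y z z0 h1 h2.
by nra.
Qed.

(** Singleton buckets occupy distinct dyadic scales, so their mass is a geometric sum governed by
    the lowest occupied bucket, whose eigenvalue exceeds 2^-(j+1) and is at most [tau]. *)
Lemma singleton_buckets_sum (T : {set 'I_d}) (tau : R) :
  0 <= tau -> T \subset supp lam ->
  (forall i, i \in T -> #|bucket (b i)| = 1%N) ->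
  (forall i, i \in T -> lam i <= tau) ->
  \sum_(i in T) lam i <= 4 * tau.
Proof.
move=> tau0 Ts T1 Tl.
case: (set_0Vmem T) => [->|[i0 hi0]]; first by rewrite big_set0 mulr_ge0.
pose i1 := [arg min_(i < i0 in T) b i].
have [hi1 hmin] : i1 \in T /\ forall i, i \in T -> (b i1 <= b i)%N.
  by rewrite /i1; case: arg_minnP.
have Tsup i : i \in T -> i \in supp lam by move/(fintype.subsetP Ts).
have h1 : \sum_(i in T) lam i <= \sum_(k < J | (b i1 <= k)%N) 2 ^- k.
  apply: le_trans (_ : \sum_(i in T) 2 ^- (g i) <= _).
    by apply: ler_sum => i iT; rewrite gE; have [] := hb (Tsup _ iT).
  rewrite (partition_big g (fun k => (b i1 <= k)%N)) /=; last first.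
    by move=> i iT; rewrite gE hmin.
  apply: ler_sum => k _.
  rewrite (eq_bigr (fun _ => 2 ^- k)); last by move=> i /andP[_ /eqP ->].
  rewrite sumr_const -[leLHS]mulr_natr ler_piMr ?(ltW (inv2X_gt0 _)) // lern1.
  rewrite leqNgt; apply/negP => /card_gt1P[x [y [hx hy]]] /negP; apply.
  move: hx hy; rewrite !unfold_in => /andP[xT /eqP gx] /andP[yT /eqP gy].
  have bxy : b x = b y by rewrite -!gE gx gy.
  have /eqP/cards1P[z hz] := T1 _ xT.
  have : x \in bucket (b x) by exact/mem_bucket/Tsup.
  have : y \in bucket (b x) by rewrite bxy; exact/mem_bucket/Tsup.
  by rewrite hz !inE => /eqP -> /eqP ->.
apply: le_trans h1 _; apply: le_trans (geometric_tail_le _ _ _) _.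
have [h _] := hb (Tsup _ hi1); have := Tl _ hi1.
by rewrite inv2XS in h; lra.
Qed.

Lemma kept_bucket_bound (U : 'M[C]_d) (eps : R) n (M : 'M[C]_(d ^ n)) i :
  (2 <= d)%N -> U \is unitarymx -> 0 < eps -> eps < 1 / 12%:R ->
  certifies (U *m cplx (dmx lam) *m adjmx U) eps n M ->
  i \in supp lam ->
  12%:R * eps < \sum_(k in supp lam | lhat lam k <= lhat lam i) lam k ->
  #|bucket (b i)|%:R ^+ 2 * 2 ^- (b i) <= 1764 * n%:R * eps ^+ 2.
Proof.
move=> d2 hU e0 e1 hc hi hT.
have D0 := card_bucket_gt0 hi.
have ne0 : 0 <= n%:R * eps ^+ 2 by rewrite mulr_ge0 ?sqr_ge0.
case: (ltngtP 1%N #|bucket (b i)|) => D1; last 2 first.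
- by rewrite ltnNge D0 in D1.
- rewrite -D1 expr1n mul1r.
  apply: le_trans (certifies_universal d2 hU lam0 lam1 e0 e1 hc).
  by rewrite -[leRHS]invr1 -[in leRHS](expr0 2); exact: inv2X_le.
set D := #|bucket (b i)|%:R : R.
have D2 : 2 <= D by rewrite ler_nat.
set x : R := 2 ^- b i.
have x0 : 0 < x by exact: inv2X_gt0.
have xE : 2 ^+ b i * x = 1 by rewrite mulfV // gt_eqF // exprn_gt0.
have X0 : 0 < 2 ^+ b i :> R by rewrite exprn_gt0.
suff : D ^+ 2 * x <= 384 * n%:R * eps ^+ 2 by rewrite -!mulrA in ne0 *; lra.
(* If the bucket of [i] is heavy, it is used alone. *)
case: (lerP (4 * eps) (x * D)) => hp.
  have K2 k : k \in [set g i] -> (2 <= #|bucket k|)%N.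
    by rewrite inE => /eqP ->; rewrite gE.
  have hk0 (k : 'I_J) : k \in [set g i] -> (b i <= k)%N.
    by rewrite inE => /eqP ->; rewrite gE.
  have := bucket_union_bound hU e0 hc K2 hk0.
  rewrite /= big_set1 gE -/x -/D => /(_ hp).
  by rewrite mul_inv_sq.
pose tau := lhat lam i.
have tauE : tau * D = lam i by rewrite /tau lhatE // -/D mulfVK // gt_eqF //; lra.
have [_ lx] := hb hi; rewrite -/x in lx.
have tau0 : 0 <= tau by rewrite /tau lhatE // divr_ge0.
(* Here tau D^2 = lam_i D < 4 eps and D >= 2. Singleton buckets below [tau] then carry less than 4
   eps, leaving over 8 eps for the buckets in [K]. *)
have taue : tau < eps.
  have : tau * D * D < 4 * eps by rewrite tauE; nra.
  by move=> h; rewrite ltNge; apply/negP => h'; nra.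
pose K : {set 'I_J} := [set k : 'I_J | (2 <= #|bucket k|)%N &&
  [exists i' in bucket k, lhat lam i' <= tau]].
have K2 k : k \in K -> (2 <= #|bucket k|)%N by rewrite inE => /andP[].
pose p := \sum_(k in K) 2 ^- k * #|bucket k|%:R : R.
have hp4 : 4 * eps <= p.
  pose T := [set k in supp lam | (lhat lam k <= tau) && (g k \notin K)].
  have Ts : T \subset supp lam by apply/fintype.subsetP => k; rewrite !inE => /andP[].
  have Tb k : k \in T -> #|bucket (b k)| = 1%N.
    move=> kT; have ks := fintype.subsetP Ts _ kT.
    move: kT; rewrite !inE negb_and gE => /andP[_ /andP[hl /orP[h|]]].
      by apply/eqP; rewrite eqn_leq leqNgt h card_bucket_gt0.
    by rewrite negb_exists => /forallP/(_ k); rewrite mem_bucket // hl.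
  have Tl k : k \in T -> lam k <= tau.
    move=> kT; have ks := fintype.subsetP Ts _ kT; have := Tb _ kT.
    move: kT; rewrite !inE => /andP[_ /andP[hl _]] h1.
    by move: hl; rewrite lhatE // h1 divr1.
  have s1 := singleton_buckets_sum tau0 Ts Tb Tl.
  have s2 : \sum_(k in supp lam | lhat lam k <= tau) lam k <=
      \sum_(k in T) lam k + p.
    rewrite (bigID (fun k => g k \in K)) /= addrC; apply: lerD.
      rewrite le_eqVlt; apply/orP; left; apply/eqP.
      by apply: eq_bigl => k; rewrite [RHS]inE andbA.
    rewrite (partition_big g (mem K)) /=; last by move=> k /andP[].
    apply: ler_sum => k kK.
    have -> : 2 ^- k * #|bucket k|%:R = \sum_(i in bucket k) 2 ^- k :> R.
      by rewrite sumr_const mulr_natr.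
    rewrite big_mkcond [leRHS]big_mkcond; apply: ler_sum => a _.
    case: ifP => [/andP[/andP[/andP[as_ _] _] /eqP ga]|_].
      have -> : a \in bucket k by rewrite -ga gE mem_bucket.
      by have [_] := hb as_; rewrite -gE ga.
    by case: ifP => _ //; exact/ltW/inv2X_gt0.
  by move: hT; rewrite -/tau; lra.
have [k1 k1K] : exists k, k \in K.
  case: (set_0Vmem K) => [K0|[k kK]]; last by exists k.
  by move: hp4; rewrite /p K0 big_set0; lra.
pose k2 := [arg min_(k < k1 in K) (k : nat)].
have [k2K hk0] : k2 \in K /\ forall k : 'I_J, k \in K -> (k2 <= k)%N.
  by rewrite /k2; case: arg_minnP.
have := bucket_union_bound hU e0 hc K2 hk0 hp4; rewrite -/p.
apply: le_trans.
(* If all buckets of [K] lie at or beyond that of [i], then p >= 4 eps > x D already suffices. *)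
case: (leqP (b i) k2) => hjk.
  rewrite -(mul_inv_sq D xE).
  have : 2 ^+ b i <= 2 ^+ k2 :> R by rewrite ler_weXn2l // ler1n.
  have : (x * D) ^+ 2 <= p ^+ 2.
    by rewrite ler_sqr ?nnegrE ?mulr_ge0 //; lra.
  move=> h1 h2; apply: ler_pM => //; [exact: ltW | exact: sqr_ge0].
have := k2K; rewrite inE => /andP[_ /existsP[a /andP[ab ha]]].
have [as_ ba la _] := bucketP ab.
set y : R := 2 ^- k2; set E := #|bucket k2|%:R : R.
have y0 : 0 < y by exact: inv2X_gt0.
have E0 : 0 < E by rewrite ltr0n; apply/card_gt0P; exists a.
have xy : x <= 2 ^- k2.+1 by exact: inv2X_le.
(* The element [a] has a larger eigenvalue than [i] but no larger [lhat], so its bucket is at least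
   as big; the term of bucket [k2] alone then suffices. *)
have DE : D <= E.
  have hE : lam a <= tau * E.
    by move: ha; rewrite lhatE // ba -/E ler_pdivrMr.
  have : lam i < lam a by exact: le_lt_trans lx (le_lt_trans xy la).
  rewrite -tauE => /lt_le_trans/(_ hE) h'.
  have tp : 0 < tau.
    rewrite lt_def tau0 andbT; apply/eqP => t0.
    by rewrite t0 !mul0r ltxx in h'.
  by rewrite ltr_pM2l // in h'; exact: ltW.
have yE : 2 ^+ k2 * y = 1 by rewrite mulfV // gt_eqF // exprn_gt0.
have pE : y * E <= p.
  rewrite /p (bigD1 k2) //= lerDl sumr_ge0 // => k _.
  by rewrite mulr_ge0 // ltW // inv2X_gt0.
have yE0 : 0 <= y * E by rewrite mulr_ge0 // ltW.
apply: le_trans (_ : 2 ^+ k2 * (y * E) ^+ 2 <= _); last first.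
  apply: ler_wpM2l; first by rewrite exprn_ge0.
  by rewrite ler_sqr ?nnegrE // (le_trans yE0).
have D00 : 0 <= D by exact: ler0n.
rewrite mul_inv_sq //; apply: ler_pM; rewrite ?sqr_ge0 ?(ltW x0) //.
  by rewrite ler_sqr ?nnegrE // (ltW E0).
exact: le_trans xy (inv2X_le (leqnSn _)).
Qed.

End FixedSpectrum.
End Buckets.

(** * Mass removal *)

Section MassRemovalOrder.
Variable R : realType.
Local Notation C := R[i].

Lemma density_spectrum d (sigma U : 'M[C]_d) (lam : 'I_d -> R) :
  density sigma -> U \is unitarymx ->
  sigma = U *m diag_mx (\row_j (lam j)%:C) *m adjmx U ->
  [/\ forall i, 0 <= lam i, \sum_i lam i = 1 &
      sigma = U *m cplx (dmx lam) *m adjmx U].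
Proof.
move=> [pS tS] hU; rewrite -cplx_dmx => sE; split => //.
  move=> i; have := psd_conj (adjmx U) pS.
  rewrite sE adjmxK !mulmxA unitaryVl // mul1mx mulmx_unitaryK //.
  move=> [_ /(_ (delta_mx 0 i))].
  have -> : adjmx (delta_mx 0 i : 'rV[C]_d) = delta_mx i 0.
    rewrite /adjmx trmx_delta; apply/matrixP => a c; rewrite !mxE.
    by case: andP => _; rewrite ?conjc1 ?conjc0 //=; apply/eqP;
      rewrite eq_complex /= ?oppr0 !eqxx.
  rewrite -rowE -colE !mxE eqxx mulr1n lecE /= => /andP[_].
  by [].
by move: tS; rewrite sE mxtrace_conj // mxtrace_dmx => /(congr1 (@complex.Re R)).
Qed.

Lemma sum_take_le d (lam : 'I_d -> R) (eps : R) (s : seq 'I_d) k :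
  (dprime lam eps s < k < size s)%N ->
  12%:R * eps < \sum_(i <- take k s) lam i.
Proof.
move=> /andP[h1 h2]; rewrite ltNge; apply/negP => h.
move: h1; rewrite ltnNge => /negP; apply.
by rewrite /dprime (leq_bigmax_cond (Ordinal h2)).
Qed.

(** The prefix of [s] ending at [i] is longer than the removed one, so its mass exceeds 12 eps, and
    by sortedness it contains only indices with [lhat] at most that of [i]. *)
Lemma kept_mass d (lam : 'I_d -> R) (eps : R) (s : seq 'I_d) i :
  (forall i, 0 <= lam i) -> \sum_i lam i = 1 -> eps < 1 / 12%:R ->
  valid_order lam s -> i \in drop (dprime lam eps s) s ->
  i \in supp lam /\
  12%:R * eps < \sum_(k in supp lam | lhat lam k <= lhat lam i) lam k.
Proof.
move=> lam0 lam1 e1 [ps so] hi.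
have us : uniq s by rewrite (perm_uniq ps) enum_uniq.
have ms k : (k \in s) = (k \in supp lam) by rewrite (perm_mem ps) mem_enum.
have his : i \in s by exact: mem_drop hi.
split; first by rewrite -ms.
have hr : (dprime lam eps s <= index i s)%N.
  rewrite leqNgt; apply/negP => lt.
  have : i \in take (dprime lam eps s) s by rewrite in_take.
  move: us; rewrite -{1}(cat_take_drop (dprime lam eps s) s) cat_uniq.
  by move=> /and3P[_ /hasPn/(_ _ hi)/negP].
have hlt : (index i s < size s)%N by rewrite index_mem.
apply: lt_le_trans (_ : \sum_(k <- take (index i s).+1 s) lam k <= _).
  (* [dprime] ranges only over proper prefixes. If [i] is last, the prefix is all of [s], with mass
     1 > 12 eps. *)
  case: (ltnP (index i s).+1 (size s)) => h; first by apply: sum_take_le; rewrite ltnS hr.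
  rewrite take_oversize //.
  have -> : \sum_(k <- s) lam k = 1.
    rewrite (perm_big _ ps) big_enum /= -lam1 [RHS](bigID (mem (supp lam))) /=.
    rewrite [X in _ = _ + X]big1 ?addr0 // => k.
    by rewrite inE negbK => /eqP.
  lra.
rewrite big_uniq ?take_uniq //= big_mkcond [leRHS]big_mkcond /=.
apply: ler_sum => k _; case: ifP => [kt|_]; last by case: ifP.
have ks : k \in s by exact: mem_take kt.
rewrite -ms ks /=.
have -> // : lhat lam k <= lhat lam i.
have hk : (index k s <= index i s)%N by rewrite -ltnS -in_take.
have tr : transitive (fun a c => lhat lam a <= lhat lam c).
  by move=> a c e; exact: le_trans.
have := sorted_leq_nth tr (fun a => lexx _) i so.
move=> /(_ (index k s) (index i s)); rewrite !inE !index_mem => /(_ ks his hk).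
by rewrite !nth_index.
Qed.

Lemma ln2_ge_half : 1 / 2 <= ln (2 : R).
Proof.
rewrite -ler_expR lnK ?posrE //.
have h := expR_ge1Dx (- (1 / 2) : R); rewrite expRN in h.
have E0 := expR_gt0 (1 / 2 : R).
have E1 : expR (1 / 2) * (expR (1 / 2))^-1 = 1 :> R by rewrite mulfV ?gt_eqF.
by nra.
Qed.

Lemma ln_ratio_ge1 d (eps : R) : (2 <= d)%N -> 0 < eps -> eps < 1 / 12%:R ->
  1 <= ln (d%:R / eps).
Proof.
move=> d2 e0 e1; have dd : 2 <= d%:R :> R by rewrite ler_nat.
have q4 : 4 <= d%:R / eps by rewrite ler_pdivlMr //; nra.
have h := ln2_ge_half.
have : ln 2 + ln 2 <= ln (d%:R / eps).
  have p0 : 0 < d%:R / eps by lra.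
  have p4 : 2 * 2 <= d%:R / eps by lra.
  by rewrite -lnM ?posrE // ler_ln ?posrE // mulr_gt0.
by lra.
Qed.

Section KeptIndices.
Variables (d : nat) (lam : 'I_d -> R) (b : 'I_d -> nat).
Hypothesis lam0 : forall i, 0 <= lam i.
Hypothesis hb : forall i, i \in supp lam -> in_bucket (b i) (lam i).

(** Every counted eigenvalue is lam_k = d_j(k) lhat_k <= d lam_i, so 12 eps < d^2 2^-(b i). Hence
    2^(b i) <= (d/eps)^2, and ln 2 >= 1/2 gives the factor 4. *)
Lemma kept_index_bound (eps : R) i :
  (2 <= d)%N -> 0 < eps -> eps < 1 / 12%:R -> i \in supp lam ->
  12%:R * eps < \sum_(k in supp lam | lhat lam k <= lhat lam i) lam k ->
  (b i)%:R <= 4 * ln (d%:R / eps).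
Proof.
move=> d2 e0 e1 hi hT; have [_ lb] := hb hi.
pose D k : R := #|bucket lam b (b k)|%:R.
have D0 k : k \in supp lam -> 1 <= D k.
  by move=> hk; rewrite ler1n; exact: card_bucket_gt0.
have Dd k : D k <= d%:R by rewrite ler_nat -[leqRHS]card_ord; exact: max_card.
have d0 : 2 <= d%:R :> R by rewrite ler_nat.
have hl : lhat lam i <= lam i.
  by rewrite (lhatE hb) // ler_pdivrMr ?ler_peMr ?D0 // (lt_le_trans _ (D0 _ hi)).
have h1 : 12%:R * eps < d%:R * (d%:R * lam i).
  apply: lt_le_trans hT _.
  apply: le_trans (_ : \sum_(k < d) d%:R * lam i <= _); last first.
    by rewrite sumr_const card_ord -[leLHS]mulr_natl.
  rewrite big_mkcond; apply: ler_sum => k _.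
  case: ifP => [/andP[ks hk]|_]; last by rewrite mulr_ge0.
  have -> : lam k = D k * lhat lam k.
    rewrite (lhatE hb) // -/(D k) mulrC mulfVK // gt_eqF //.
    exact: lt_le_trans (D0 _ ks).
  apply: ler_pM => //; last exact: le_trans hl.
  by rewrite (lhatE hb) // divr_ge0.
pose y : R := d%:R / eps.
have yE : d%:R = y * eps by rewrite mulfVK // gt_eqF.
have y0 : 0 < y by rewrite divr_gt0 //; lra.
have X0 : 0 < 2 ^+ b i :> R by rewrite exprn_gt0.
have hx : 2 ^+ b i <= y ^+ 2.
  have : 12%:R * eps < d%:R * (d%:R * 2 ^- b i).
    by apply: lt_le_trans h1 _; rewrite !ler_wpM2l.
  rewrite !mulrA ltr_pdivlMr // yE => h.
  have : 12%:R * eps * 2 ^+ b i < 12%:R * eps * y ^+ 2.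
    apply: lt_le_trans h _.
    have -> : y * eps * (y * eps) = eps * y ^+ 2 * eps by ring.
    have -> : 12%:R * eps * y ^+ 2 = eps * y ^+ 2 * 12%:R by ring.
    by apply: ler_wpM2l; [rewrite mulr_ge0 ?sqr_ge0 // ltW | lra].
  by rewrite ltr_pM2l ?mulr_gt0 // => /ltW.
have : ln (2 ^+ b i) <= ln (y ^+ 2) :> R.
  by rewrite ler_ln ?posrE // exprn_gt0.
rewrite !lnXn // -/y -(mulr_natl (ln 2)) mulr2n.
have N0 : 0 <= (b i)%:R :> R by [].
by have := ln2_ge_half; move: (ln 2) (ln y) N0; move: ((b i)%:R) => N u v *; nra.
Qed.

(** Each of the m + 1 buckets contributes at most 1: its size times the inverse of its size. *)
Lemma sum_inv_bucket_le (A : {set 'I_d}) m :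
  A \subset supp lam -> (forall i, i \in A -> (b i <= m)%N) ->
  \sum_(i in A) (#|bucket lam b (b i)|%:R : R)^-1 <= m%:R + 1.
Proof.
move=> As Am; pose g i : 'I_m.+1 := inord (b i).
have gE i : i \in A -> g i = b i :> nat.
  by move=> /Am h; rewrite inordK // ltnS.
rewrite (partition_big g xpredT) //=.
have -> : m%:R + 1 = \sum_(k < m.+1) (1 : R).
  by rewrite sumr_const card_ord natr1.
apply: ler_sum => k _.
case: (posnP #|bucket lam b k|) => [c0|c0].
  rewrite big1 // => i /andP[iA /eqP gi].
  by rewrite -(gE _ iA) gi c0 invr0.
apply: le_trans (_ : \sum_(i in bucket lam b k) (#|bucket lam b k|%:R : R)^-1 <= _).
  rewrite big_mkcond [leRHS]big_mkcond; apply: ler_sum => i _.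
  case: ifP => [/andP[iA /eqP gi]|_].
    have bi : b i = k by rewrite -(gE _ iA) gi.
    by rewrite bi inE (fintype.subsetP As _ iA) bi eqxx.
  by case: ifP => _ //; rewrite invr_ge0.
by rewrite sumr_const -[leLHS]mulr_natr mulVf // pnatr_eq0 -lt0n.
Qed.

End KeptIndices.

(* Each kept eigenvalue satisfies [d_j(i) * sqrt lam_i <= 42 eps sqrt n], so
   summing over the at most [4 ln (d/eps) + 1] kept buckets loses two logs. *)
Lemma kept_sqrt_sum d (U : 'M[C]_d) (lam : 'I_d -> R) (eps : R) (s : seq 'I_d) n
    (M : 'M[C]_(d ^ n)) :
  (2 <= d)%N -> 0 < eps -> eps < 1 / 12%:R -> U \is unitarymx ->
  (forall i, 0 <= lam i) -> \sum_i lam i = 1 ->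
  valid_order lam s ->
  certifies (U *m cplx (dmx lam) *m adjmx U) eps n M ->
  \sum_(i | i \in drop (dprime lam eps s) s) Num.sqrt (lam i) <=
    Num.sqrt (1764 * n%:R * eps ^+ 2) * (5 * ln (d%:R / eps)).
Proof.
move=> d2 e0 e1 hU lam0 lam1 hs hc.
have lamle i : lam i <= 1.
  by rewrite -lam1 (bigD1 i) //= lerDl sumr_ge0.
have [b hb] := bucket_index_exists lam0 lamle.
pose A := [set i in drop (dprime lam eps s) s].
have L1 := ln_ratio_ge1 d2 e0 e1; set L := ln _ in L1 *.
have kept i : i \in A -> i \in supp lam /\
    12%:R * eps < \sum_(k in supp lam | lhat lam k <= lhat lam i) lam k.
  by rewrite inE => hi; exact: kept_mass hi.
have As : A \subset supp lam by apply/fintype.subsetP => i /kept[].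
set H := Num.sqrt _; have H0 : 0 <= H by exact: sqrtr_ge0.
have bound i : i \in A -> Num.sqrt (lam i) <= H * (#|bucket lam b (b i)|%:R)^-1.
  move=> /kept[hi hT]; have D0 : 0 < #|bucket lam b (b i)|%:R :> R.
    by rewrite ltr0n; exact: card_bucket_gt0.
  rewrite ler_pdivlMr // mulrC -{1}(ger0_norm (ltW D0)) -sqrtr_sqr.
  rewrite -sqrtrM ?sqr_ge0 // ler_wsqrtr //.
  apply: le_trans (kept_bucket_bound lam0 lam1 hb d2 hU e0 e1 hc hi hT).
  by apply: ler_wpM2l; [exact: sqr_ge0 | have [] := hb _ hi].
rewrite (eq_bigl (mem A)); last by move=> i; rewrite /= inE.
apply: le_trans (ler_sum _ bound) _; rewrite -mulr_sumr; apply: ler_wpM2l => //.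
case: (set_0Vmem A) => [->|[i0 hi0]]; first by rewrite big_set0; lra.
pose i1 := [arg max_(i > i0 in A) b i].
have [hi1 hmax] : i1 \in A /\ forall i, i \in A -> (b i <= b i1)%N.
  by rewrite /i1; case: arg_maxnP.
apply: le_trans (sum_inv_bucket_le As hmax) _.
have [hs1 hT1] := kept _ hi1.
(* The largest kept bucket index is at most 4 L, and 4 L + 1 <= 5 L because L >= 1. *)
by have := kept_index_bound lam0 hb d2 e0 e1 hs1 hT1; rewrite -/L; lra.
Qed.

End MassRemovalOrder.

Theorem theorem5p1 :
  exists c Cexp : rat, 0 < c /\ 0 < Cexp /\
  forall (R : realType) (d : nat) (eps : R) (sigma : 'M[R[i]]_d)
         (U : 'M[R[i]]_d) (lam : 'I_d -> R) (s : seq 'I_d)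
         (n : nat) (M : 'M[R[i]]_(d ^ n)),
    (2 <= d)%N -> 0 < eps -> eps < 1 / 12%:R ->
    density sigma ->
    U \is unitarymx ->
    sigma = U *m diag_mx (\row_j (lam j)%:C) *m adjmx U ->
    valid_order lam s ->
    certifies sigma eps n M ->
    ratr c * schatten (1 / 2%:R) (sigma_star lam eps s)
      / (eps ^+ 2 * powR (ln (d%:R / eps)) (ratr Cexp)) <= n%:R.
Proof.
(* Squaring the bound on the sum of square roots gives 1764 * 25 = 210^2 and two logarithms. *)
exists (210%:R ^- 2), 2%:R; split; first by rewrite invr_gt0 exprn_gt0.
split=> // R d eps sigma U lam s n M d2 e0 e1 dS hU sE hs hc.
have [lam0 lam1 sE'] := density_spectrum dS hU sE.
rewrite sE' in hc.
have := kept_sqrt_sum d2 e0 e1 hU lam0 lam1 hs hc.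
have L1 := ln_ratio_ge1 d2 e0 e1; set L := ln _ in L1 *.
have L0 : 0 < L by lra.
have -> : ratr (2%:R : rat) = 2%:R :> R by rewrite ratr_nat.
rewrite powR_mulrn ?(ltW L0) // fmorphV rmorphXn /= ratr_nat.
pose mu i := if i \in drop (dprime lam eps s) s then lam i else 0.
have mu0 i : 0 <= mu i by rewrite /mu; case: ifP.
have := schatten_half_diag_le mu0; rewrite -/(sigma_star lam eps s).
have -> : \sum_i Num.sqrt (mu i) =
    \sum_(i | i \in drop (dprime lam eps s) s) Num.sqrt (lam i).
  rewrite [RHS]big_mkcond; apply: eq_bigr => i _; rewrite /mu.
  by case: ifP => // _; rewrite sqrtr0.
have t0 : 0 <= \sum_(i | i \in drop (dprime lam eps s) s) Num.sqrt (lam i).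
  by apply: sumr_ge0 => i _; exact: sqrtr_ge0.
have ne0 : 0 <= 1764 * n%:R * eps ^+ 2 by apply: mulr_ge0; [apply: mulr_ge0 | exact: sqr_ge0].
have := sqr_sqrtr ne0; have := sqrtr_ge0 (1764 * n%:R * eps ^+ 2).
move: (Num.sqrt _) (schatten _ _) t0; move: (\sum_(i | _) _) => t H S t0 H0 H2 hS ht.
have D0 : 0 < eps ^+ 2 * L ^+ 2 by rewrite mulr_gt0 // exprn_gt0.
rewrite ler_pdivrMr // ler_pdivrMl ?exprn_gt0 //.
apply: le_trans hS _.
apply: le_trans (_ : (H * (5 * L)) ^+ 2 <= _).
  by rewrite ler_sqr ?nnegrE // (le_trans t0).
rewrite exprMn H2 le_eqVlt; apply/orP; left; apply/eqP; ring.
Qed.
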